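(* Let $(M,J)$ be a compact almost complex manifold with $J$ of class $C^2$. Then $(M,J)$ is not hyperbolic if and only if there exists a non-constant $J$-holomorphic map $f:\mathbb{C}\to (M,J)$ (a non-trivial $J$-complex line).
   Context: An almost complex manifold is a pair $(M,J)$ where $M$ is a real manifold, countable at infinity, and $J$ is a $C^1$-smooth section of $\mathrm{End}(TM)$ with $J^2=-\mathrm{Id}$. If $(S,J_S)$ is a Riemann surface, a $C^1$-smooth map $u:S\to M$ is called $J$-holomorphic if $du\circ J_S=J\circ du$ as maps $TS\to TM$. $\mathbb{C}$ and the open unit disk $\Delta=\{z\in\mathbb{C}:|z|<1\}$ carry their standard complex structures. Let $\rho$ be the Lobachevski distance on $\Delta$, i.e. the distance associated with the metric $\frac{dz\otimes d\bar z}{(1-|z|^2)^2}$. Kobayashi pseudo-distance (for $J$ of class $C^2$): for $p,q\in M$, consider all choices of an integer $k\ge 1$, points $p=p_0,p_1,\dots,p_k=q$ of $M$, points $a_1,\dots,a_k,b_1,\dots,b_k\in\Delta$ and $J$-holomorphic maps $f_1,\dots,f_k:\Delta\to M$ with $f_i(a_i)=p_{i-1}$ and $f_i(b_i)=p_i$ for $i=1,\dots,k$. Then $k_M^J(p,q)$ is the infimum of $\sum_{i=1}^k\rho(a_i,b_i)$ over all such choices (with the convention that the infimum of the empty set is $+\infty$, relevant only for points in different connected components). $(M,J)$ is called hyperbolic if $k_M^J$ is an actual distance, i.e. $k_M^J(p,q)=0$ implies $p=q$. *)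

(* Defs.v *)
From HB Require Import structures.
From mathcomp Require Import all_boot all_order all_algebra.
From mathcomp Require Import all_classical all_reals all_analysis.

Set Implicit Arguments.
Unset Strict Implicit.
Unset Printing Implicit Defensive.

Import Order.TTheory GRing.Theory Num.Theory.
Import numFieldNormedType.Exports.

Local Open Scope classical_set_scope.
Local Open Scope ring_scope.

(* Only meant for [U] open: the germ of [f] at every point of [U] is then
   determined by its restriction to [U].  The directional derivatives being
   required in every direction [v], this is the usual class C^k for maps between
   finite-dimensional spaces. *)
Fixpoint Ck (R : realType) (V W : normedModType R) (k : nat) (U : set V)
    (f : V -> W) : Prop :=
  if k is k'.+1 then
    (forall x, U x -> differentiable f x) /\
    (forall v : V, Ck k' U (fun x => 'd f x v))
  else forall x, U x -> {for x, continuous f}.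

(* A homeomorphism between an open set of [M] and an open set of R^n; [fwd] and
   [bwd] are total functions whose values off [dom] and [cod] are irrelevant. *)
Record chart (R : realType) (M : topologicalType) (n : nat) := Chart {
  dom : set M;
  cod : set 'rV[R]_n;
  fwd : M -> 'rV[R]_n;
  bwd : 'rV[R]_n -> M;
  dom_open : open dom;
  cod_open : open cod;
  fwd_cod : forall p, dom p -> cod (fwd p);
  bwd_dom : forall x, cod x -> dom (bwd x);
  fwdK : forall p, dom p -> bwd (fwd p) = p;
  bwdK : forall x, cod x -> fwd (bwd x) = x;
  fwd_continuous : forall p, dom p -> {for p, continuous fwd};
  bwd_continuous : forall x, cod x -> {for x, continuous bwd}
}.

Section Transition.
Context (R : realType) (M : topologicalType) (n : nat) (c d : chart R M n).

Definition overlap : set 'rV[R]_n := cod c `&` bwd c @^-1` dom d.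

Definition transition : 'rV[R]_n -> 'rV[R]_n := fwd d \o bwd c.

End Transition.

(* C^oo manifold without boundary, of real dimension [n].  The atlas need not be
   maximal.  [mfd_sigma_compact] is countability at infinity. *)
Record manifold (R : realType) (M : topologicalType) (n : nat) := Manifold {
  mfd_hausdorff : hausdorff_space M;
  mfd_sigma_compact : exists K : nat -> set M,
    (forall m, compact (K m)) /\ \bigcup_m K m = [set: M];
  atlas_index : Type;
  atlas : atlas_index -> chart R M n;
  atlas_cover : forall p : M, exists i, dom (atlas i) p;
  atlas_smooth : forall i j k,
    Ck k (overlap (atlas i) (atlas j)) (transition (atlas i) (atlas j))
}.

(* A section of End(TM) of class C^k with square -Id, given by its matrices in
   the charts.  Tangent vectors are row vectors, on which matrices act on the
   right; [acs_compat] says that the local expressions transform as the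
   coordinates of a section of End(TM). *)
Record almost_complex (R : realType) (M : topologicalType) (n : nat)
    (X : manifold R M n) (k : nat) := AlmostComplex {
  acs : atlas_index X -> 'rV[R]_n -> 'M[R]_n;
  acs_Ck : forall i, Ck k (cod (atlas i)) (acs i);
  acs_sq : forall i x, cod (atlas i) x -> acs i x *m acs i x = - 1%:M;
  acs_compat : forall i j x, overlap (atlas i) (atlas j) x ->
    forall v : 'rV[R]_n,
      'd (transition (atlas i) (atlas j)) x (v *m acs i x) =
      'd (transition (atlas i) (atlas j)) x v
        *m acs j (transition (atlas i) (atlas j) x)
}.

Section Disk.
Context (R : realType).

(* The complex plane as a real normed space, (x, y) standing for x + iy.  The
   norm of the product [R * R] is the sup norm, hence the explicit modulus. *)
Definition plane : normedModType R := (R * R)%type.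

Definition mul_i (z : plane) : plane := (- z.2, z.1).

Definition modulus (z : plane) : R := Num.sqrt (z.1 ^+ 2 + z.2 ^+ 2).

Definition disk : set plane := [set z | modulus z < 1].

(* Length for the metric dz (x) d\bar z / (1 - |z|^2)^2, whose norm on tangent
   vectors at z is |v| / (1 - |z|^2). *)
Definition hyp_length (g : R -> plane) : \bar R :=
  (\int[lebesgue_measure]_(t in `[0%R, 1%R])
     (modulus (derive1 g t) / (1 - modulus (g t) ^+ 2))%:E)%E.

Definition disk_path (a b : plane) (g : R -> plane) : Prop :=
  [/\ Ck 1 [set: R] g, g 0 = a, g 1 = b &
      forall t : R, 0 <= t <= 1 -> disk (g t)].

(* The Lobachevski distance. *)
Definition rho (a b : plane) : \bar R :=
  ereal_inf [set hyp_length g | g in [set g | disk_path a b g]].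

End Disk.

Section Kobayashi.
Context (R : realType) (M : topologicalType) (n : nat) (X : manifold R M n)
        (k : nat) (J : almost_complex X k).

(* [f : D -> M] is C^1 and J-holomorphic on the open subset [D] of the complex
   plane; the values of [f] off [D] are irrelevant. *)
Definition J_holomorphic (D : set (plane R)) (f : plane R -> M) : Prop :=
  (forall z, D z -> {for z, continuous f}) /\
  forall i : atlas_index X,
    Ck 1 (D `&` f @^-1` dom (atlas i)) (fwd (atlas i) \o f) /\
    forall z, D z -> dom (atlas i) (f z) -> forall v : plane R,
      'd (fwd (atlas i) \o f) z (mul_i v) =
      'd (fwd (atlas i) \o f) z v *m acs J i (fwd (atlas i) (f z)).

(* The i-th disk, 0 <= i < m, joins p_i to p_{i+1}. *)
Definition kobayashi_chain (p q : M) (m : nat) (s : nat -> M)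
    (a b : nat -> plane R) (f : nat -> plane R -> M) : Prop :=
  [/\ s 0%N = p, s m = q &
      forall i, (i < m)%N ->
        [/\ disk (a i), disk (b i), J_holomorphic (@disk R) (f i),
            f i (a i) = s i & f i (b i) = s i.+1]].

Definition kobayashi (p q : M) : \bar R :=
  ereal_inf [set r : \bar R | exists m s a b f,
    [/\ (1 <= m)%N, kobayashi_chain p q m s a b f &
        r = (\sum_(i < m) rho (a i) (b i))%E]].

Definition hyperbolic : Prop := forall p q : M, kobayashi p q = 0%E -> p = q.

End Kobayashi.

(* Main.v *)
From HB Require Import structures.
Require Import Defs.
From mathcomp Require Import all_boot all_order all_algebra.
From mathcomp Require Import all_classical all_reals all_analysis.
From mathcomp Require Import ring lra.

(** If [f] is a J-holomorphic line, the disks [f (s z)] join [f z] to [f w] between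
    the points [z / s] and [w / s], whose Lobachevski distance tends to 0 as [s] grows.
    So the pseudo-distance of [f z] and [f w] vanishes, and a nonconstant line
    destroys hyperbolicity ([kobayashi_line]).

    The converse is Brody's argument. Differentials are measured in finitely many
    charts ([box_system]); the resulting function [box_speed] is not continuous, but
    other choices of charts change it by a bounded factor only. If the speeds at the
    centre of all J-holomorphic disks are bounded, affine reparametrizations of a disk
    bound its speed at [z] by a constant over [1 - |z|^2]. Distances in a chart are then
    dominated by the pseudo-distance, which therefore separates points
    ([bounded_speed_hyperbolic]). Otherwise, rescaling disks of large speed around
    points where the speed is almost maximal for a weight vanishing at the boundary
    gives maps [h k] on balls of radius [k + 1] with speed 1 at 0 and speed at most 4
    ([brody_reparametrization]). By compactness of the manifold they converge pointwise
    along an ultrafilter. The limit is J-holomorphic on the whole plane and is not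
    constant ([limit_holomorphic], [limit_nonconstant]).

    Passing to the limit requires that a uniform bound on the first derivatives of
    J-holomorphic maps yields a uniform modulus of continuity of these derivatives
    ([equicontinuous_diff]). This comes from a perturbed Cauchy formula. Let [J0] be the
    value of [J] at [u z0], let [v] be the difference of [u] at the point of polar
    coordinates [r, t] around [z0] and of [u z0], and let [A] be exp(-t J0), which is
    [rotN J0 t]. The equation for [u] gives

      d/dr (v A / r) = - (1 / r^2) d/dt (v J0 A) + (1 / r) v_r (J(u) - J0) J0 A.

    The first term has mean 0 over the circle. The second one is bounded, since [J] is
    Lipschitz and [u] has bounded derivatives. As [r] tends to 0, the mean of [v A / r]
    tends to the derivative of [u] at [z0] in the first direction, which is therefore
    within a multiple of [r] of the mean over the circle of radius [r]
    ([mean_value_estimate]); and that mean depends on [z0] in a Lipschitz way, because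
    it involves only the values of [u] ([mean_deriv_dist]). Means over roots of unity
    stand for the integrals. *)

Set Implicit Arguments.
Unset Strict Implicit.
Unset Printing Implicit Defensive.

Import Order.TTheory GRing.Theory Num.Theory.
Import numFieldNormedType.Exports.

Local Open Scope classical_set_scope.
Local Open Scope ring_scope.

(** * Matrix norms, growth along intervals, differentials *)

Section MatrixNorm.
Context {R : realType}.

Lemma mx_entry_le m n (A : 'M[R]_(m, n)) i j : `|A i j| <= `|A|.
Proof.
by rewrite [leRHS]/Num.Def.normr/= mx_normrE (le_bigmax _ _ (i, j)).
Qed.

Lemma mx_norm_le m n (A : 'M[R]_(m, n)) (c : R) :
  0 <= c -> (forall i j, `|A i j| <= c) -> `|A| <= c.
Proof.
move=> c0 Ac; rewrite /Num.Def.normr/= mx_normrE.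
by apply: bigmax_le => // -[i j] _; exact: Ac.
Qed.

Lemma mulmx_norm_le m n p (A : 'M[R]_(m, n)) (B : 'M[R]_(n, p)) :
  `|A *m B| <= n%:R * `|A| * `|B|.
Proof.
apply: mx_norm_le; first by rewrite !mulr_ge0.
move=> i j; rewrite mxE (le_trans (ler_norm_sum _ _ _))//.
have -> : n%:R * `|A| * `|B| = \sum_(k < n) `|A| * `|B|.
  by rewrite sumr_const card_ord -mulrA mulr_natl.
by apply: ler_sum => k _; rewrite normrM ler_pM// mx_entry_le.
Qed.

Lemma cvg_mulmx (T : Type) (F : set_system T) (FF : Filter F) m n p
    (A : T -> 'M[R]_(m, n)) (B : T -> 'M[R]_(n, p)) (a : 'M[R]_(m, n))
    (b : 'M[R]_(n, p)) :
  A x @[x --> F] --> a -> B x @[x --> F] --> b ->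
  A x *m B x @[x --> F] --> a *m b.
Proof.
move=> Aa Bb.
have An : `|A x - a| @[x --> F] --> (0 : R).
  by rewrite -(@normr0 _ 'M[R]_(m, n)) -(subrr a); apply: cvg_norm;
    apply: cvgB => //; exact: cvg_cst.
have Bn : `|B x - b| @[x --> F] --> (0 : R).
  by rewrite -(@normr0 _ 'M[R]_(n, p)) -(subrr b); apply: cvg_norm;
    apply: cvgB => //; exact: cvg_cst.
apply/cvgrPdist_le => e e0.
have : n%:R * `|A x - a| * `|B x - b| + n%:R * `|a| * `|B x - b| +
    n%:R * `|A x - a| * `|b| @[x --> F] -->
    n%:R * 0 * 0 + n%:R * `|a| * 0 + n%:R * 0 * `|b|.
  by apply: cvgD; [apply: cvgD|]; (apply: cvgM; [apply: cvgM|]) => //; exact: cvg_cst.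
rewrite !(mulr0, mul0r, addr0) => /cvgrPdist_le/(_ e e0).
apply: filterS => x; rewrite sub0r normrN => /(le_trans (ler_norm _));
  apply: le_trans.
have -> : a *m b - A x *m B x =
   - ((A x - a) *m (B x - b) + a *m (B x - b) + (A x - a) *m b).
  rewrite !mulmxBl !mulmxBr; apply/eqP; rewrite -subr_eq0; apply/eqP.
  by apply/matrixP => i j; rewrite !mxE; ring.
rewrite normrN; apply: le_trans (ler_normD _ _) _; rewrite lerD ?mulmx_norm_le//.
by apply: le_trans (ler_normD _ _) _; rewrite lerD ?mulmx_norm_le.
Qed.

End MatrixNorm.

Section Growth.
Context {R : realType}.

Lemma within_continuous_coord (a b : R) m n (f : R -> 'M[R]_(m, n)) i j :
  {within `[a, b], continuous f} ->
  {within `[a, b], continuous (fun t => f t i j)}.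
Proof.
move=> cf x; apply: (@cvg_comp _ _ _ f (fun M : 'M[R]_(m, n) => M i j) _ _ _ (cf x)).
exact: coord_continuous.
Qed.

(** The mean value inequality for curves, with the bound on the velocity itself
    given by the derivative of a scalar function: applied entrywise to the maximum
    norm, it loses no constant. *)
Lemma growth_le (a b : R) m n (f : R -> 'M[R]_(m, n)) (phi : R -> R) :
  a <= b -> {within `[a, b], continuous f} ->
  {within `[a, b], continuous phi} ->
  (forall t, t \in `]a, b[ ->
    [/\ derivable f t 1, derivable phi t 1 & `|'D_1 f t| <= 'D_1 phi t]) ->
  `|f b - f a| <= phi b - phi a.
Proof.
move=> ab cf cphi H.
have abs (g : R -> R) : {within `[a, b], continuous g} ->
    (forall t, t \in `]a, b[ -> derivable g t 1 /\ 'D_1 g t <= 'D_1 phi t) ->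
    g b - g a <= phi b - phi a.
  move=> cg Hg; have /(_ (g - phi)) := @ler0_derive1_le_cc R _ a b.
  move=> /(_ _ _ _ b a); rewrite !in_itv/= !lexx ab/= => E.
  have : (g - phi) b <= (g - phi) a.
    apply: E => // [t tab|t tab|].
    - by apply: derivableB; [have [] := Hg t tab|have [] := H t tab].
    - have [dg lg] := Hg t tab; have [_ dphi _] := H t tab.
      by rewrite derive1E deriveB// subr_le0.
    - by move=> x; apply: cvgB; [exact: cg|exact: cphi].
  rewrite !fctE; lra.
have phi0 : 0 <= phi b - phi a.
  have := abs (cst 0); rewrite subrr; apply; first by move=> x; exact: cvg_cst.
  move=> t tab; split; first exact: derivable_cst.
  by rewrite derive_cst; have [_ _] := H t tab; apply: le_trans.
apply: mx_norm_le => // i j; rewrite !mxE ler_norml; apply/andP; split; last first.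
  apply: (abs (fun t => f t i j)); first exact: within_continuous_coord.
  move=> t tab; have [df _ le] := H t tab.
  split; first by move/derivable_mxP : df.
  apply: le_trans le; apply: le_trans (mx_entry_le _ i j).
  by rewrite (derive_mx df) mxE ler_norm.
suff : - f b i j - - f a i j <= phi b - phi a by lra.
apply: (abs (fun t => - f t i j)).
  by move=> x; apply: cvgN; exact: within_continuous_coord.
move=> t tab; have [df _ le] := H t tab.
have dij : derivable (fun t => f t i j) t 1 by move/derivable_mxP : df.
split; first exact: derivableN.
rewrite deriveN//; apply: le_trans le; apply: le_trans (mx_entry_le _ i j).
by rewrite (derive_mx df) mxE -normrN ler_norm.
Qed.

End Growth.

Section Differential.
Context {R : realType}.

Lemma is_diff_eps (V W : normedModType R) (f : V -> W) (df : {linear V -> W}) x :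
  continuous df ->
  (forall e, 0 < e -> \forall z \near x, `|f z - f x - df (z - x)| <= e * `|z - x|) ->
  is_diff x f df.
Proof.
move=> cdf H.
have E : f \o shift x = cst (f x) + df +o_ 0 id.
  apply/eqaddoP => _/posnumP[e]; have /H : 0 < e%:num by [].
  rewrite (near_shift 0)/= => He; near=> h.
  have : `|f (h + (x - 0)) - f x - df (h + (x - 0) - x)| <=
      e%:num * `|h + (x - 0) - x| by near: h.
  by rewrite subr0 addrK !fctE /= opprD addrA.
have Ed := diff_unique cdf E.
constructor; last by [].
apply/diff_locallyP; split; first by rewrite Ed.
by rewrite Ed.
Unshelve. all: by end_near. Qed.

Lemma diff_eps (V W : normedModType R) (f : V -> W) x : differentiable f x ->
  forall e, 0 < e ->
  \forall z \near x, `|f z - f x - 'd f x (z - x)| <= e * `|z - x|.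
Proof.
move=> /diff_locally /eqaddoP df e e0; have {}df := df e e0.
rewrite (near_shift 0)/=; near=> h.
rewrite /= subr0 addrK.
have : `|(f \o shift x - (cst (f x) + 'd f x)) h| <= e * `|h| by near: h.
by rewrite !fctE /= opprD addrA.
Unshelve. all: by end_near. Qed.

Lemma near_eq_diff (V W : normedModType R) (f g : V -> W) x :
  (\forall z \near x, f z = g z) -> differentiable f x ->
  differentiable g x /\ forall v, 'd g x v = 'd f x v.
Proof.
move=> fg df; have fgx := nbhs_singleton fg.
suff [dg eg] : is_diff x g ('d f x) by split=> // v; exact: (congr1 (@^~ v) eg).
apply: is_diff_eps; first exact: diff_continuous.
by move=> e e0; have := diff_eps df e0; apply: filterS2 fg => z; rewrite fgx => ->.
Qed.

Lemma diff_compE (U V W : normedModType R) (f : U -> V) (g : V -> W) x v :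
  differentiable f x -> differentiable g (f x) ->
  'd (g \o f) x v = 'd g (f x) ('d f x v).
Proof. by move=> df dg; exact: (congr1 (@^~ v) (diff_comp df dg)). Qed.

End Differential.

(** * Curves, segments and uniform continuity *)

Section Curves.
Context {R : realType}.

Lemma is_derive_comp (V W : normedModType R) (f : V -> W) (g : R -> V) (t : R) dg :
  is_derive t (1 : R) g dg -> differentiable f (g t) ->
  is_derive t (1 : R) (f \o g) ('d f (g t) dg).
Proof.
move=> [dgt <-] df.
have {}dgt : differentiable g t by apply/derivable1_diffP.
have dfg := differentiable_comp dgt df.
constructor; first exact: diff_derivable.
by rewrite (deriveE _ dfg) (diff_comp dgt df)/= (deriveE _ dgt).
Qed.

Lemma is_derive_line (V : normedModType R) (x v : V) (t : R) :
  is_derive t (1 : R) (fun s : R => x + s *: v) v.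
Proof.
pose lv (s : R) := s *: v.
have [dl vl] : is_diff t lv lv by exact: is_diff_scalel.
have il : is_derive t (1 : R) lv v.
  constructor; first exact: diff_derivable.
  by rewrite (deriveE _ dl) vl /lv scale1r.
have := is_deriveD (is_derive_cst x t (1 : R)) il.
by rewrite add0r.
Qed.

(** Subtracting a fixed [w] gives both the Lipschitz bound ([w = 0]) and, when [w]
    is a value of the differential, the error in the first-order expansion. *)
Lemma segment_growth (V : normedModType R) m n (f : V -> 'M[R]_(m, n)) (x y : V)
    (w : 'M[R]_(m, n)) (c : R) :
  (forall t : R, 0 <= t <= 1 -> differentiable f (x + t *: (y - x)) /\
     `|'d f (x + t *: (y - x)) (y - x) - w| <= c) ->
  `|f y - f x - w| <= c.
Proof.
move=> H.
pose l (s : R) := x + s *: (y - x).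
pose lw (s : R) := 0 + s *: w.
pose lc (s : R) := 0 + s *: (c : R^o).
pose g := (f \o l) - lw.
have dg (t : R) : 0 <= t <= 1 -> is_derive t (1 : R) g ('d f (l t) (y - x) - w).
  move=> t01; have [df _] := H t t01.
  exact: (is_deriveB (is_derive_comp (is_derive_line x (y - x) t) df)
    (is_derive_line 0 w t)).
have dc (t : R) : is_derive t (1 : R) lc c by exact: is_derive_line.
have := @growth_le R 0 1 _ _ g lc ler01.
have -> : g 1 - g 0 = f y - f x - w.
  rewrite /g /l /lw !fctE/= !scale1r !scale0r !addr0 subr0 add0r.
  by rewrite addrCA subrr addr0 addrAC.
have -> : lc 1 - lc 0 = c by rewrite /lc scale1r scale0r !add0r subr0.
apply.
- apply: derivable_within_continuous => t; rewrite in_itv/= => t01.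
  by have [] := dg t t01.
- apply: derivable_within_continuous => t _; by have [] := dc t.
- move=> t; rewrite in_itv/= => /andP[t0 t1].
  have t01 : 0 <= t <= 1 by rewrite !ltW.
  have [d1 e1] := dg t t01; have [d2 e2] := dc t; have [_ le] := H t t01.
  by split; [exact: d1|exact: d2|rewrite e1 e2].
Qed.

Lemma near_ball (V : normedModType R) (c z : V) (r : R) :
  ball c r z -> \forall y \near z, ball c r y.
Proof.
move=> cz; have r0 : 0 < r.
  by move: cz; rewrite -ball_normE /ball_/=; exact: le_lt_trans.
by apply: open_nbhs_nbhs; split => //; exact: ball_open.
Qed.

Lemma segment_ball (V : normedModType R) (c x y : V) (r t : R) :
  ball c r x -> ball c r y -> 0 <= t <= 1 -> ball c r (x + t *: (y - x)).
Proof.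
rewrite -!ball_normE /ball_/= => xr yr /andP[t0 t1].
have -> : c - (x + t *: (y - x)) = (1 - t) *: (c - x) + t *: (c - y).
  rewrite scalerBl scale1r addrAC -addrA -scalerBr.
  have -> : c - y - (c - x) = - (y - x).
    by rewrite opprB addrC subrKA opprB.
  by rewrite scalerN opprD addrA.
apply: le_lt_trans (ler_normD _ _) _; rewrite !normrZ ger0_norm ?subr_ge0//.
rewrite ger0_norm//.
have [->|tn0] := eqVneq t 0; first by rewrite subr0 mul1r mul0r addr0.
have tp : 0 < t by rewrite lt_def tn0.
have : (1 - t) * `|c - x| <= (1 - t) * r by rewrite ler_wpM2l ?subr_ge0// ltW.
have : t * `|c - y| < t * r by rewrite ltr_pM2l.
lra.
Qed.

Lemma compact_unif_continuous (V W : normedModType R) (f : V -> W) (K : set V) :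
  compact K -> (forall x, K x -> {for x, continuous f}) ->
  forall e, 0 < e ->
  exists2 d, 0 < d & forall p q, K p -> `|p - q| < d -> `|f p - f q| <= e.
Proof.
move=> /compact_near_coveringP cK cf e e0.
have := cK R (0 : R)^'+ (fun d p => forall q, `|p - q| < d -> `|f p - f q| <= e) _.
case=> [x Kx|d /= d0 Hd].
  have /cvgrPdist_le/(_ (e / 2)) := cf x Kx.
  rewrite divr_gt0// => /(_ isT)/nbhs_normP[d /= d0 Hd].
  exists (ball x (d / 2), [set s | s < d / 2]).
    split; first by apply: nbhsx_ballx; rewrite divr_gt0.
    by apply: nbhs_right_lt; rewrite divr_gt0.
  move=> [p s] /=; rewrite -ball_normE/= => -[xp sd] q pq.
  rewrite -(subrKA (f x)) (splitr e); apply: le_trans (ler_normD _ _) _.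
  apply: lerD; first by rewrite distrC Hd//=; apply: lt_trans xp _; lra.
  apply: Hd => /=; rewrite -(subrKA p); apply: le_lt_trans (ler_normD _ _) _.
  lra.
exists (d / 2); first by rewrite divr_gt0.
move=> p q Kp pq; apply: (Hd (d / 2)) => //=.
  by rewrite sub0r normrN gtr0_norm ?divr_gt0//; lra.
by rewrite divr_gt0.
Qed.

(** One step of a Riemann sum of a derivative, with the error controlled by its
    oscillation. *)
Lemma riemann_step m n (F F' : R -> 'M[R]_(m, n)) (t h e : R) :
  0 <= h -> (forall s : R, is_derive s (1 : R) F (F' s)) ->
  (forall s, t <= s <= t + h -> `|F' s - F' t| <= e) ->
  `|F (t + h) - F t - h *: F' t| <= h * e.
Proof.
move=> h0 dF eF; apply: segment_growth.
have -> : t + h - t = h by ring.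
move=> s /andP[s0 s1].
have [dFs vF] := dF (t + s *: h).
have dd : differentiable F (t + s *: h) by apply/derivable1_diffP.
split; first exact: dd.
rewrite (deriv1E dFs) derive1E vF -scalerBr normrZ (ger0_norm h0).
apply: ler_wpM2l; first exact: h0.
apply: eF; rewrite lerDl mulr_ge0//= lerD2l.
by rewrite -[leRHS]mul1r ler_wpM2r.
Qed.

End Curves.

(** * Polar coordinates and rotations by an almost complex structure *)

Section Circle.
Context {R : realType}.

Definition eit (t : R) : plane R := (cos t, sin t).

Lemma plane_norm_le (w : plane R) (c : R) :
  `|w.1| <= c -> `|w.2| <= c -> `|w| <= c.
Proof. by move=> h1 h2; rewrite prod_normE ge_max h1 h2. Qed.

Lemma plane_norm_fst (w : plane R) : `|w.1| <= `|w|.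
Proof. by rewrite prod_normE le_max lexx. Qed.

Lemma plane_norm_snd (w : plane R) : `|w.2| <= `|w|.
Proof. by rewrite prod_normE le_max lexx orbT. Qed.

Lemma norm_eit t : `|eit t| <= 1.
Proof.
apply: plane_norm_le; rewrite /= ler_norml.
  by rewrite cos_geN1 cos_le1.
by rewrite sin_geN1 sin_le1.
Qed.

Lemma norm_cos t : `|cos t : R| <= 1.
Proof. by rewrite ler_norml cos_geN1 cos_le1. Qed.

Lemma norm_sin t : `|sin t : R| <= 1.
Proof. by rewrite ler_norml sin_geN1 sin_le1. Qed.

Lemma diff_plane (W : normedModType R) (f : plane R -> W) z w :
  'd f z w = w.1 *: 'd f z (1, 0) + w.2 *: 'd f z (0, 1).
Proof.
have {1}-> : w = w.1 *: ((1, 0) : plane R) + w.2 *: ((0, 1) : plane R).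
  case: w => a b; congr pair; rewrite /= /GRing.scale/=; ring.
by rewrite linearD !linearZ.
Qed.

(** A differential is determined by two vectors, so pointwise convergence of the
    differentials suffices to let the argument vary as well. *)
Lemma cvg_diff_plane (W : normedModType R) (T : Type) (F : set_system T)
    (FF : Filter F) (f : plane R -> W) (z w : T -> plane R) (z0 w0 : plane R) :
  (forall v, 'd f (z t) v @[t --> F] --> 'd f z0 v) -> w t @[t --> F] --> w0 ->
  'd f (z t) (w t) @[t --> F] --> 'd f z0 w0.
Proof.
move=> cd cw.
have gen (D : plane R -> plane R -> W) :
    (forall z w, D z w = w.1 *: D z (1, 0) + w.2 *: D z (0, 1)) ->
    (forall v, D (z t) v @[t --> F] --> D z0 v) ->
    D (z t) (w t) @[t --> F] --> D z0 w0.
  move=> DE cD; rewrite DE; under eq_cvg do rewrite DE.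
  apply: cvgD; apply: cvgZ; try exact: cD.
    exact: (cvg_comp _ _ cw cvg_fst).
  exact: (cvg_comp _ _ cw cvg_snd).
exact: (gen (fun z v => 'd f z v) (diff_plane f) cd).
Qed.

Lemma is_derive_eit t : is_derive t (1 : R) eit (mul_i (eit t)).
Proof.
have [dc vc] := is_derive_cos t; have [ds vs] := is_derive_sin t.
have dc' : differentiable (@cos R) t by apply/derivable1_diffP.
have ds' : differentiable (@sin R) t by apply/derivable1_diffP.
have dp : differentiable eit t by exact: differentiable_pair.
constructor; first exact: diff_derivable.
rewrite (deriveE _ dp) (diff_pair dc' ds')/= (deriv1E dc) (deriv1E ds)
  !derive1E vc vs.
by rewrite /mul_i/= !scale1r.
Qed.

Lemma continuous_eit : continuous eit.
Proof.
move=> t; apply: differentiable_continuous.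
by apply/derivable1_diffP; have [] := is_derive_eit t.
Qed.

End Circle.

(** A [J]-holomorphic curve in a chart, with the constants on which the uniform
    estimates depend: a bound [C] on the differential, a bound [b] on [J] along the
    curve, and a Lipschitz constant [L] of [J] composed with the curve. *)
Record curve_bounds (R : realType) (n : nat) (J : 'rV[R]_n -> 'M[R]_n)
    (C L b : R) (c : plane R) (r : R) (u : plane R -> 'rV[R]_n) : Prop := {
  cb_diff : forall z, ball c r z -> differentiable u z;
  cb_cont : forall w z, ball c r z -> {for z, continuous (fun y => 'd u y w)};
  cb_holo : forall z, ball c r z -> forall w,
    'd u z (mul_i w) = 'd u z w *m J (u z);
  cb_speed : forall z, ball c r z -> forall w, `|'d u z w| <= C * `|w|;
  cb_lip : forall z z', ball c r z -> ball c r z' ->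
    `|J (u z) - J (u z')| <= L * `|z - z'|;
  cb_sq : forall z, ball c r z -> J (u z) *m J (u z) = - 1%:M;
  cb_norm : forall z, ball c r z -> `|J (u z)| <= b }.

Section Mean.
Context {R : realType} {n : nat}.
Implicit Types (J : 'rV[R]_n -> 'M[R]_n) (u : plane R -> 'rV[R]_n).

Lemma curve_boundsW J C L b c r u c' r' : ball c' r' `<=` ball c r ->
  curve_bounds J C L b c r u -> curve_bounds J C L b c' r' u.
Proof.
move=> s [h1 h2 h3 h4 h5 h6 h7]; split.
- by move=> z /s; exact: h1.
- by move=> w z /s; exact: h2.
- by move=> z /s; exact: h3.
- by move=> z /s; exact: h4.
- by move=> z z' /s hz /s; exact: h5.
- by move=> z /s; exact: h6.
- by move=> z /s; exact: h7.
Qed.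

(** The complex number exp(-it), acting through [J0] on row vectors. *)
Definition rotN (J0 : 'M[R]_n) (t : R) : 'M[R]_n :=
  cos t *: 1%:M - sin t *: J0.
(** The product of [J0] and [rotN J0 t], and a primitive of [rotN J0] in [t]. *)
Definition rotNJ (J0 : 'M[R]_n) (t : R) : 'M[R]_n :=
  sin t *: 1%:M + cos t *: J0.

Lemma norm_mx1 : `|(1%:M : 'M[R]_n)| <= 1.
Proof.
by apply: mx_norm_le => // i j; rewrite mxE; case: eqP => _; rewrite ?normr1 ?normr0.
Qed.

Lemma norm_rotN (J0 : 'M[R]_n) t : `|rotN J0 t| <= 1 + `|J0|.
Proof.
apply: le_trans (ler_normB _ _) _; apply: lerD.
  by rewrite normrZ mulr_ile1 ?norm_mx1 ?norm_cos.
by rewrite normrZ ler_piMl// norm_sin.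
Qed.

Lemma norm_rotNJ (J0 : 'M[R]_n) t : `|rotNJ J0 t| <= 1 + `|J0|.
Proof.
apply: le_trans (ler_normD _ _) _; apply: lerD.
  by rewrite normrZ mulr_ile1 ?norm_mx1 ?norm_sin.
by rewrite normrZ ler_piMl// norm_cos.
Qed.

Lemma mul_rotNJ (J0 : 'M[R]_n) t : J0 *m J0 = - 1%:M ->
  J0 *m rotNJ J0 t = - rotN J0 t.
Proof.
move=> JJ; rewrite mulmxDr -!scalemxAr JJ mulmx1.
by apply/matrixP => i j; rewrite !mxE; case: (i == j); rewrite ?mulr1n ?mulr0n; ring.
Qed.

Lemma mul_rotN (J0 : 'M[R]_n) t : J0 *m J0 = - 1%:M -> J0 *m rotN J0 t = rotNJ J0 t.
Proof.
move=> JJ; rewrite mulmxBr -!scalemxAr JJ mulmx1.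
by apply/matrixP => i j; rewrite !mxE; case: (i == j); rewrite ?mulr1n ?mulr0n; ring.
Qed.

(** The product of exp(it) and exp(-it). *)
Lemma rot_rotN (J0 : 'M[R]_n) t : J0 *m J0 = - 1%:M ->
  (cos t *: 1%:M + sin t *: J0) *m rotN J0 t = 1%:M.
Proof.
move=> JJ; rewrite mulmxDl -!scalemxAl mul1mx mul_rotN// /rotN /rotNJ.
have := cos2Dsin2 t; move: (cos t) (sin t) => x y xy.
apply/matrixP => i j; rewrite !mxE.
transitivity ((x ^+ 2 + y ^+ 2) * (i == j)%:R); first by ring.
by rewrite xy mul1r.
Qed.

Lemma is_derive_scalel (W : normedModType R) (k : R -> R) dk (w : W) (t : R) :
  is_derive t (1 : R) k dk -> is_derive t (1 : R) (fun s => k s *: w) (dk *: w).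
Proof.
move=> dkt; have := is_derive_comp (f := fun s : R => 0 + s *: w) dkt.
have [d v] := is_derive_line 0 w (k t).
have d' : differentiable (fun s : R => 0 + s *: w) (k t) by apply/derivable1_diffP.
move=> /(_ d'); rewrite (deriv1E d) derive1E v.
rewrite (_ : _ \o _ = (fun s => k s *: w))// funeqE => s /=.
by rewrite add0r.
Qed.

Lemma is_derive_rotNJ (J0 : 'M[R]_n) t : is_derive t (1 : R) (rotNJ J0) (rotN J0 t).
Proof.
have := is_deriveD (is_derive_scalel (1%:M : 'M[R]_n) (is_derive_sin t))
  (is_derive_scalel J0 (is_derive_cos t)).
by rewrite scaleNr.
Qed.

Lemma continuous_rotNJ (J0 : 'M[R]_n) : continuous (rotNJ J0).
Proof.
move=> t; apply: differentiable_continuous.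
by apply/derivable1_diffP; have [] := is_derive_rotNJ J0 t.
Qed.

Lemma continuous_rotN (J0 : 'M[R]_n) : continuous (rotN J0).
Proof.
by move=> t; apply: cvgB; apply: cvgZl; [exact: continuous_cos|exact: continuous_sin].
Qed.

Lemma is_derive_mulmx m p q (A : R -> 'M[R]_(m, p)) (B : R -> 'M[R]_(p, q)) dA dB
    (t : R) : is_derive t (1 : R) A dA -> is_derive t (1 : R) B dB ->
  is_derive t (1 : R) (fun s => A s *m B s) (dA *m B t + A t *m dB).
Proof.
move=> [dAt vA] [dBt vB].
have dAij i k : derivable (fun s => A s i k) t 1 by move/derivable_mxP : dAt.
have dBij k j : derivable (fun s => B s k j) t 1 by move/derivable_mxP : dBt.
have E i j : (fun s => (A s *m B s) i j) =
    \sum_(k < p) (fun s => A s i k * B s k j).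
  by rewrite funeqE => s; rewrite mxE fct_sumE.
have dk i j k : derivable (fun s => A s i k * B s k j) t 1.
  exact: (derivableM (dAij i k) (dBij k j)).
have dAB : derivable (fun s => A s *m B s) t 1.
  apply/derivable_mxP => i j; rewrite E; apply: derivable_sum => k; exact: dk.
constructor; first exact: dAB.
rewrite (derive_mx dAB); apply/matrixP => i j; rewrite !mxE E.
rewrite derive_sum; last by move=> k; exact: dk.
rewrite -big_split/=; apply: eq_bigr => k _.
rewrite (deriveM (dAij i k) (dBij k j)).
rewrite -vA -vB (derive_mx dAt) (derive_mx dBt) !mxE addrC.
by congr (_ + _); rewrite /GRing.scale/= mulrC.
Qed.

End Mean.

(** * A mean value formula for J-holomorphic curves *)

Section MeanDerivative.
Context {R : realType} {n : nat}.

Definition node (N k : nat) : R := k%:R * (2 * pi / N%:R).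

Definition circle (z0 : plane R) (r t : R) : plane R := z0 + r *: eit t.

(** For a holomorphic [u] and large [N] this approximates Cauchy's integral for
    the derivative of [u] at [z0] over the circle of radius [r]. *)
Definition mean_deriv (J0 : 'M[R]_n) (u : plane R -> 'rV[R]_n) (z0 : plane R)
    (N : nat) (r : R) : 'rV[R]_n :=
  N%:R^-1 *: \sum_(k < N)
    (u (circle z0 r (node N k)) - u z0) *m (r^-1 *: rotN J0 (node N k)).

End MeanDerivative.

Section MeanEstimate.
Context {R : realType} {n : nat}.
Variables (J : 'rV[R]_n -> 'M[R]_n) (C L b : R) (z0 : plane R) (r0 : R)
  (u : plane R -> 'rV[R]_n).
Hypothesis H : curve_bounds J C L b z0 r0 u.
Hypotheses (C0 : 0 <= C) (L0 : 0 <= L) (b0 : 0 <= b) (r00 : 0 < r0).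

(* [Ft r t] is the [t]-derivative of [v r t *m rotNJ J0 t] and [G] is the summand
   of the mean; the equation for [u] links the [r]-derivative of [G] to [Ft]. *)
Let J0 := J (u z0).
Let pt := circle z0.
Let v (r t : R) : 'rV[R]_n := u (pt r t) - u z0.
Let Ft (r t : R) : 'rV[R]_n :=
  (r *: ('d u (pt r t) (eit t) *m J (u (pt r t)))) *m rotNJ J0 t + v r t *m rotN J0 t.
Let G (r t : R) : 'rV[R]_n := v r t *m (r^-1 *: rotN J0 t).

Let z0in : ball z0 r0 z0. Proof. exact: ballxx. Qed.

Let norm_pt r t : `|pt r t - z0| <= `|r|.
Proof. by rewrite /pt /circle addrAC subrr add0r normrZ ler_piMr// norm_eit. Qed.

Let ptin r t : `|r| < r0 -> ball z0 r0 (pt r t).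
Proof.
move=> rr; rewrite -ball_normE /ball_/= distrC.
exact: le_lt_trans (norm_pt r t) rr.
Qed.

Let J0J0 : J0 *m J0 = - 1%:M. Proof. exact: (cb_sq H). Qed.

Let is_derive_ptt r t : `|r| < r0 -> is_derive t (1 : R) (fun s => u (pt r s))
  (r *: ('d u (pt r t) (eit t) *m J (u (pt r t)))).
Proof.
move=> rr; have zin := ptin t rr.
have dp : is_derive t (1 : R) (fun s => pt r s) (r *: mul_i (eit t)).
  have := is_deriveD (is_derive_cst z0 t (1 : R)) (is_deriveZ r (is_derive_eit t)).
  by rewrite add0r.
have := is_derive_comp (f := u) dp (cb_diff H zin).
by rewrite linearZ/= (cb_holo H zin).
Qed.

Let is_derive_Ft r t : `|r| < r0 ->
  is_derive t (1 : R) (fun s => v r s *m rotNJ J0 s) (Ft r t).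
Proof.
move=> rr; apply: is_derive_mulmx; last exact: is_derive_rotNJ.
have := is_deriveB (is_derive_ptt t rr) (is_derive_cst (u z0) t (1 : R)).
by rewrite subr0.
Qed.

Let continuous_Ft (p : R * R) : `|p.1| < r0 ->
  {for p, continuous (fun q : R * R => Ft q.1 q.2)}.
Proof.
case: p => r t /= rr; have zin := ptin t rr.
have c1 : (fun q : R * R => q.1) @ (r, t) --> r by exact: cvg_fst.
have c2 : (fun q : R * R => q.2) @ (r, t) --> t by exact: cvg_snd.
have ce : (fun q : R * R => eit q.2) @ (r, t) --> eit t.
  by apply: (cvg_comp _ _ c2); exact: continuous_eit.
have cpt : (fun q : R * R => pt q.1 q.2) @ (r, t) --> pt r t.
  by apply: cvgD; [exact: cvg_cst|exact: cvgZ].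
have cu : (fun q : R * R => u (pt q.1 q.2)) @ (r, t) --> u (pt r t).
  exact: (cvg_comp _ _ cpt (differentiable_continuous (cb_diff H zin))).
have cd (w : plane R) : (fun q : R * R => 'd u (pt q.1 q.2) w) @ (r, t) -->
  'd u (pt r t) w.
  exact: (cvg_comp _ _ cpt (cb_cont H zin)).
have cJ : (fun q : R * R => J (u (pt q.1 q.2))) @ (r, t) --> J (u (pt r t)).
  have cJz : (fun z => J (u z)) @ (pt r t) --> J (u (pt r t)).
    apply/cvgrPdist_le => e e0.
    have : \forall z \near pt r t, ball z0 r0 z by exact: near_ball.
    have L1 : 0 < e / (L + 1) by rewrite divr_gt0// ltr_wpDl.
    have := nbhsx_ballx (pt r t) _ L1; apply: filterS2 => z zz zb.
    move: zz; rewrite -ball_normE /ball_/= => /ltW zz.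
    apply: le_trans (cb_lip H zin zb) _.
    apply: (@le_trans _ _ (L * (e / (L + 1)))); first by rewrite ler_wpM2l.
    by rewrite mulrCA ler_piMr ?(ltW e0)// ler_pdivrMr ?mul1r ?lerDl// ltr_wpDl.
  exact: (cvg_comp _ _ cpt cJz).
have cB : (fun q : R * R => rotNJ J0 q.2) @ (r, t) --> rotNJ J0 t.
  by apply: (cvg_comp _ _ c2); exact: continuous_rotNJ.
have cA : (fun q : R * R => rotN J0 q.2) @ (r, t) --> rotN J0 t.
  by apply: (cvg_comp _ _ c2); exact: continuous_rotN.
have cde : (fun q : R * R => 'd u (pt q.1 q.2) (eit q.2)) @ (r, t) -->
  'd u (pt r t) (eit t).
  exact: cvg_diff_plane.
apply: cvgD; apply: cvg_mulmx.
- by apply: cvgZ; [exact: c1|apply: cvg_mulmx; [exact: cde|exact: cJ]].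
- exact: cB.
- by apply: cvgB; [exact: cu|exact: cvg_cst].
- exact: cA.
Qed.

Let is_derive_inv (r : R) : r != 0 -> is_derive r (1 : R) (fun s : R => s^-1)
  (- r ^- 2).
Proof.
move=> r0'; have did : derivable (@id R) r (1 : R) by exact: derivable_id.
constructor; first exact: (derivableV r0' did).
have := deriveV r0' did; rewrite derive_id => ->.
by rewrite /GRing.scale/= mulr1.
Qed.

(* The defect from the integrable case [J = J0]; it stays bounded as [r] tends to 0
   because [J (u z) - J0] is of order [r]. *)
Let E (r t : R) : 'rV[R]_n := r^-1 *: ('d u (pt r t) (eit t) *m (J (u (pt r t))
  - J0) *m rotNJ J0 t).

Let is_derive_G r t : 0 < r < r0 ->
  is_derive r (1 : R) (fun s => G s t) (- r ^- 2 *: Ft r t + E r t).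
Proof.
move=> /andP[rp rr].
have rr' : `|r| < r0 by rewrite gtr0_norm.
have zin := ptin t rr'.
have dv : is_derive r (1 : R) (fun s => v s t) ('d u (pt r t) (eit t)).
  have := is_derive_comp (f := u) (is_derive_line z0 (eit t) r) (cb_diff H zin).
  move=> /is_deriveB/(_ (is_derive_cst (u z0) r (1 : R))).
  by rewrite subr0.
have rn0 : r != 0 by rewrite gt_eqF.
have := is_derive_mulmx dv (is_derive_scalel (rotN J0 t) (is_derive_inv rn0)).
set X := (X in is_derive _ _ _ X -> _); set Y := (Y in _ -> is_derive _ _ _ Y).
suff -> : X = Y by [].
have eE : E r t = r^-1 *: ('d u (pt r t) (eit t) *m J (u (pt r t)) *m rotNJ J0 t +
    'd u (pt r t) (eit t) *m rotN J0 t).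
  rewrite /E (mulmxBr ('d u (pt r t) (eit t))) (mulmxBl (_ *m J (u (pt r t)))).
  by rewrite -(mulmxA _ J0) mul_rotNJ// mulmxN opprK.
rewrite /X /Y eE /Ft -!scalemxAr -!scalemxAl.
move: (_ *m rotN J0 t) (v r t *m rotN J0 t) (_ *m rotNJ J0 t) => Y1 Y2 Y3.
by apply/matrixP => i j; rewrite !mxE; field.
Qed.

Let K := n%:R * (n%:R * C * L) * (1 + b).

Let norm_E r t : 0 < r < r0 -> `|E r t| <= K.
Proof.
move=> /andP[rp rr].
have rr' : `|r| < r0 by rewrite gtr0_norm.
have zin := ptin t rr'.
rewrite /E normrZ (ger0_norm (ltW (_ : 0 < _^-1))) ?invr_gt0// ler_pdivrMl//.
apply: le_trans (mulmx_norm_le _ _) _.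
have -> : r * K = (n%:R * (n%:R * C * (L * r))) * (1 + b) by rewrite /K; ring.
apply: ler_pM => //.
  rewrite ler_wpM2l//; apply: le_trans (mulmx_norm_le _ _) _.
  apply: ler_pM => //.
    rewrite ler_wpM2l//; apply: le_trans (cb_speed H zin _) _.
    by rewrite ler_piMr// norm_eit.
  apply: le_trans (cb_lip H zin z0in) _.
  rewrite ler_wpM2l//; apply: le_trans (norm_pt r t) _.
  by rewrite ger0_norm// ltW.
by apply: le_trans (norm_rotNJ _ _) _; rewrite lerD2l; exact: (cb_norm H).
Qed.

(* The mean over a circle of the derivative of a periodic function is zero; the
   means over roots of unity are small, uniformly for [r] away from 0. *)
Let riemann (r1 r2 e : R) : 0 < r1 -> r2 < r0 -> 0 < e ->
  exists N0 : nat, forall N, (N0 < N)%N -> forall r, r1 <= r <= r2 ->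
  `|N%:R^-1 *: \sum_(k < N) Ft r (node N k)| <= e.
Proof.
move=> r1p r2p ep.
have cK : compact (`[r1, r2]%classic `*` `[0, 2 * (pi : R)]%classic).
  by apply: compact_setX; exact: segment_compact.
have [|d d0 Hd] := compact_unif_continuous (f := fun q : R * R => Ft q.1 q.2) cK _ ep.
  move=> [r t] [/=]; rewrite !in_itv/= => /andP[rr1 rr2] _; apply: continuous_Ft.
  by rewrite /= gtr0_norm; [exact: le_lt_trans rr2 r2p|exact: lt_le_trans r1p rr1].
have pi2 : 0 < 2 * (pi : R) by rewrite mulr_gt0// pi_gt0.
pose N0 := Num.bound (d^-1 * (2 * pi)).
exists N0 => N NN r /andP[rr1 rr2].
have Np : (0 < N)%N by apply: leq_ltn_trans NN.
have NR : 0 < N%:R :> R by rewrite ltr0n.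
pose h : R := 2 * pi / N%:R.
have hp : 0 < h by rewrite divr_gt0.
have hd : h < d.
  rewrite /h ltr_pdivrMr// -ltr_pdivrMl//.
  have h1 : d^-1 * (2 * pi) < N0%:R.
    by apply: archi_boundP; rewrite mulr_ge0 ?invr_ge0// ltW.
  by apply: lt_trans h1 _; rewrite ltr_nat.
have rp : 0 < r by exact: lt_le_trans r1p rr1.
have ar : `|r| < r0 by rewrite gtr0_norm//; exact: le_lt_trans rr2 r2p.
pose F t := v r t *m rotNJ J0 t.
have dF t : is_derive t (1 : R) F (Ft r t) by exact: is_derive_Ft.
have step k : (k < N)%N -> `|F (node N k.+1) - F (node N k)
  - h *: Ft r (node N k)| <= h * e.
  move=> kN; have -> : node N k.+1 = node N k + h.
    by rewrite /node -/h -natr1 mulrDl mul1r.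
  apply: riemann_step => //; first exact: ltW.
  move=> s /andP[s0 s1]; rewrite distrC.
  apply: (Hd (r, node N k) (r, s)).
    rewrite /= !in_itv/= rr1 rr2; split=> //.
    rewrite /node mulr_ge0//= ?(ltW hp)//.
    have {2}-> : 2 * pi = N%:R * (2 * pi / N%:R) :> R by field; rewrite gt_eqF.
    by rewrite ler_wpM2r ?ler_nat ?(ltW hp)// ltnW.
  apply: le_lt_trans hd; apply: plane_norm_le; rewrite /= ?subrr ?normr0;
    first exact: ltW.
  by rewrite ler0_norm; lra.
have sumF : \sum_(k < N) (F (node N k.+1) - F (node N k)) = 0.
  rewrite -(big_mkord xpredT (fun k => F (node N k.+1) - F (node N k))).
  rewrite telescope_sumr//; apply/eqP; rewrite subr_eq0; apply/eqP.
  rewrite /F /node mul0r; have -> : N%:R * (2 * pi / N%:R) = 0 + 2 * pi :> R.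
    by field; rewrite gt_eqF.
  have e2 : 2 * pi = pi *+ 2 :> R by rewrite mulr_natl.
  by rewrite /v /pt /circle /eit /rotNJ e2 sinD2pi cosD2pi.
rewrite normrZ (ger0_norm (ltW (_ : 0 < _^-1))) ?invr_gt0// ler_pdivrMl//.
have : `|\sum_(k < N) (F (node N k.+1) - F (node N k) - h *: Ft r (node N k))| <=
    \sum_(k < N) (h * e).
  by apply: le_trans (ler_norm_sum _ _ _) _; apply: ler_sum => k _; exact: step.
rewrite sumrB sumF sub0r normrN -scaler_sumr normrZ gtr0_norm//.
have -> : \sum_(k < N) (h * e) = h * (N%:R * e).
  by rewrite sumr_const card_ord mulr_natl mulrnAr.
by rewrite ler_pM2l.
Qed.

Let Q := mean_deriv J0 u z0.

(* The [r]-derivative of the mean is the mean of [E], up to the mean of [Ft]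
   divided by [r ^+ 2]. *)
Let mean_growth r1 r2 e : 0 < r1 -> r1 <= r2 -> r2 < r0 -> 0 < e ->
  exists N0, forall N, (N0 < N)%N ->
  `|Q N r2 - Q N r1| <= (r2 - r1) * (K + e).
Proof.
move=> r1p r12 r2r e0.
(* the factor [r1 ^+ 2] absorbs the division by [r ^+ 2] *)
have [|N0 HN] := @riemann r1 r2 (r1 ^+ 2 * e) r1p r2r.
  by rewrite mulr_gt0// exprn_gt0.
exists N0 => N NN.
have Np : (0 < N)%N by apply: leq_ltn_trans NN.
have NR : 0 < N%:R :> R by rewrite ltr0n.
have rb r : r1 <= r <= r2 -> 0 < r < r0.
  by move=> /andP[a c]; rewrite (lt_le_trans r1p a) (le_lt_trans c r2r).
pose D r := N%:R^-1 *: \sum_(k < N) (- r ^- 2 *: Ft r (node N k) + E r (node N k)).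
have dD r : r1 <= r <= r2 -> is_derive r (1 : R) (Q N) (D r).
  move=> /rb rr.
  have := is_deriveZ (N%:R^-1) (is_derive_sum (fun k : 'I_N =>
    is_derive_G (node N k) rr)).
  set X := (X in is_derive _ _ X _ -> _).
  suff -> : X = Q N by [].
  rewrite funeqE => s; transitivity (N%:R^-1 *: (\sum_(i < N) G^~ (node N i)) s)
    => //.
  by rewrite fct_sumE.
have bD r : r1 <= r <= r2 -> `|D r| <= K + e.
  move=> rr; have /andP[rp rlt] := rb _ rr.
  rewrite /D big_split/= scalerDr addrC; apply: le_trans (ler_normD _ _) _.
  apply: lerD.
    rewrite normrZ (ger0_norm (ltW (_ : 0 < _^-1))) ?invr_gt0// ler_pdivrMl//.
    apply: le_trans (ler_norm_sum _ _ _) _.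
    have -> : N%:R * K = \sum_(k < N) K by rewrite sumr_const card_ord mulr_natl.
    by apply: ler_sum => k _; apply: norm_E; exact: rb.
  rewrite -scaler_sumr scalerA mulrC -scalerA normrZ normrN.
  have r2p : 0 < r ^+ 2 by rewrite exprn_gt0.
  rewrite (ger0_norm (ltW (_ : 0 < _^-1))) ?invr_gt0// ler_pdivrMl//;
    apply: le_trans (HN N NN r rr) _.
  rewrite ler_pM2r//; apply: lerXn2r; rewrite ?nnegrE; [exact: ltW|exact: ltW|].
  by case/andP: rr.
pose lc (s : R) := 0 + s *: (K + e : R^o).
have dc (t : R) : is_derive t (1 : R) lc (K + e) by exact: is_derive_line.
have := @growth_le R r1 r2 _ _ (Q N) lc r12.
have -> : lc r2 - lc r1 = (r2 - r1) * (K + e).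
  by rewrite /lc !add0r -scalerBl.
apply.
- apply: derivable_within_continuous => t; rewrite in_itv/= => t01.
  by have [] := dD t t01.
- apply: derivable_within_continuous => t _; by have [] := dc t.
- move=> t; rewrite in_itv/= => /andP[t0 t1].
  have tr : r1 <= t <= r2 by rewrite !ltW.
  have [d1 e1] := dD t tr; have [d2 e2] := dc t; have le := bD t tr.
  by split; [exact: d1|exact: d2|rewrite e1 e2].
Qed.

(* On a very small circle the curve is its first-order part, whose mean is exactly
   the derivative, whatever the number of nodes. *)
Let mean_limit e : 0 < e -> exists2 d, 0 < d & forall r N, 0 < r -> r < d ->
  (0 < N)%N ->
  `|Q N r - 'd u z0 (1, 0)| <= e.
Proof.
move=> e0; pose e1 := e / (n%:R * (1 + b) + 1).
have cp : 0 < n%:R * (1 + b) + 1 :> R by rewrite ltr_wpDl// mulr_ge0// addr_ge0.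
have e1p : 0 < e1 by rewrite divr_gt0.
have /nbhs_normP[d /= d0 Hd] := diff_eps (cb_diff H z0in) e1p.
exists d => // r N rp rd Np.
have NR : 0 < N%:R :> R by rewrite ltr0n.
have one t : `|G r t - 'd u z0 (1, 0)| <= e.
  have nz : `|pt r t - z0| <= r by apply: le_trans (norm_pt r t) _; rewrite gtr0_norm.
  have /= := Hd (pt r t); rewrite /= distrC => /(_ (le_lt_trans nz rd)).
  have -> : pt r t - z0 = r *: eit t by rewrite /pt /circle addrAC subrr add0r.
  rewrite linearZ/= -/(v r t) => le1.
  have eJ : 'd u z0 (0, 1) = 'd u z0 (1, 0) *m J0.
    by rewrite -(cb_holo H z0in) /mul_i/= oppr0.
  have e2 : 'd u z0 (eit t) *m rotN J0 t = 'd u z0 (1, 0).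
    rewrite diff_plane/= eJ -[X in (cos t *: X)
      + _]mulmx1 !scalemxAr -mulmxDr -mulmxA.
    by rewrite rot_rotN// mulmx1.
  have -> : G r t - 'd u z0 (1, 0) =
      r^-1 *: ((v r t - r *: 'd u z0 (eit t)) *m rotN J0 t).
    rewrite -e2 /G -scalemxAr (mulmxBl (v r t)) -(scalemxAl r) scalerBr scalerA.
    by rewrite mulVf ?gt_eqF// scale1r.
  rewrite normrZ (ger0_norm (ltW (_ : 0 < _^-1))) ?invr_gt0// ler_pdivrMl//.
  apply: le_trans (mulmx_norm_le _ _) _.
  have nr : `|r *: eit t| <= r by rewrite normrZ gtr0_norm// ler_piMr ?norm_eit// ltW.
  apply: (@le_trans _ _ (n%:R * (e1 * r) * (1 + b))).
    apply: ler_pM => //.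
      rewrite ler_wpM2l//; apply: le_trans le1 _.
      by rewrite ler_wpM2l// ltW.
    by apply: le_trans (norm_rotN _ _) _; rewrite lerD2l; exact: (cb_norm H).
  have -> : n%:R * (e1 * r) * (1 + b) = r * (n%:R * (1 + b) * e1) by ring.
  rewrite ler_pM2l// /e1 mulrCA ler_piMr ?ltW//.
  by rewrite ltr_pdivrMr// mul1r ltrDl.
have -> : Q N r - 'd u z0 (1, 0) =
    N%:R^-1 *: \sum_(k < N) (G r (node N k) - 'd u z0 (1, 0)).
  rewrite sumrB scalerBr sumr_const card_ord -(scaler_nat _ ('d u z0 _))
    scalerA mulVf ?gt_eqF//.
  by rewrite scale1r.
rewrite normrZ (ger0_norm (ltW (_ : 0 < _^-1))) ?invr_gt0// ler_pdivrMl//.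
apply: le_trans (ler_norm_sum _ _ _) _.
have -> : N%:R * e = \sum_(k < N) e by rewrite sumr_const card_ord mulr_natl.
by apply: ler_sum => k _; exact: one.
Qed.

(** Start from a circle so small that [mean_limit] applies, and grow it to radius
    [r]: the mean moves by at most [r] times the bound on the defect. The threshold
    [N0] depends on the curve, but the inequality obtained does not. *)
Lemma mean_value_estimate r e : 0 < r < r0 -> 0 < e ->
  exists N0, forall N, (N0 < N)%N ->
  `|mean_deriv J0 u z0 N r - 'd u z0 (1, 0)| <= K * r + e.
Proof.
move=> /andP[rp rr] e0.
have [|d d0 Hd] := @mean_limit (e / 2); first by rewrite divr_gt0.
pose r1 := Num.min (r / 2) (d / 2).
have r1p : 0 < r1 by rewrite lt_min !divr_gt0.
have r1r : r1 <= r by rewrite ge_min; apply/orP; left; lra.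
have r1d : r1 < d by rewrite gt_min; apply/orP; right; lra.
have [|N0 HN] := @mean_growth r1 r (e / 2 / r) r1p r1r rr; first by rewrite !divr_gt0.
exists N0 => N NN; rewrite -(subrKA (Q N r1)).
apply: le_trans (ler_normD _ _) _.
have Np : (0 < N)%N by apply: leq_ltn_trans NN.
apply: (@le_trans _ _ ((r - r1) * (K + e / 2 / r) + e / 2)).
  by apply: lerD; [exact: HN|exact: Hd].
have K0 : 0 <= K by rewrite /K !mulr_ge0// addr_ge0.
have : (r - r1) * (K + e / 2 / r) <= r * (K + e / 2 / r).
  apply: ler_wpM2r; last by lra.
  by rewrite addr_ge0// !divr_ge0// ltW.
have -> : r * (K + e / 2 / r) = K * r + e / 2 by field; rewrite gt_eqF.
lra.
Qed.

End MeanEstimate.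

(** * Equicontinuity of the differentials and limits of curves *)

Lemma lim_norm_le (R : realType) (V : normedModType R) (T : Type) (F : set_system T)
    (FF : ProperFilter F) (f : T -> V) (l : V) (e : R) :
  f t @[t --> F] --> l -> (\forall t \near F, `|f t| <= e) -> `|l| <= e.
Proof.
move=> fl fe; apply/ler_addgt0Pr => d d0.
have [t [ft td]] : exists t, `|f t| <= e /\ `|l - f t| <= d.
  have /cvgrPdist_le/(_ d d0) fd := fl.
  have [t [h1 h2]] := @filter_ex _ F _ _ (filterI fe fd).
  by exists t.
by rewrite -(subrK (f t) l) addrC; apply: le_trans (ler_normD _ _) _; exact: lerD.
Qed.

Lemma mulmxBB (R : realType) m n p (A A' : 'M[R]_(m, n)) (B B' : 'M[R]_(n, p)) :
  A *m B - A' *m B' = (A - A') *m B + A' *m (B - B').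
Proof. by rewrite mulmxBl mulmxBr addrA subrK. Qed.

Section Equicontinuity.
Context {R : realType} {n : nat}.
Implicit Types (J : 'rV[R]_n -> 'M[R]_n) (u : plane R -> 'rV[R]_n).

Lemma curve_lipschitz J C L b c r u z z' : curve_bounds J C L b c r u ->
  ball c r z -> ball c r z' -> `|u z' - u z| <= C * `|z' - z|.
Proof.
move=> H zb zb'; rewrite -[u z' - u z]subr0; apply: segment_growth => t t01.
have tb := segment_ball zb zb' t01.
by split; [exact: (cb_diff H)|rewrite subr0; exact: (cb_speed H)].
Qed.

(** At a fixed radius the mean is Lipschitz in its centre, since it involves only
    the values of [u]. *)
Lemma mean_deriv_dist J C L b c r0 u z1 z2 N r :
  0 <= C -> 0 <= L -> 0 <= b -> (0 < N)%N -> 0 < r < r0 / 2 ->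
  curve_bounds J C L b c r0 u -> ball c (r0 / 2) z1 -> ball c (r0 / 2) z2 ->
  `|mean_deriv (J (u z1)) u z1 N r - mean_deriv (J (u z2)) u z2 N r| <=
    r^-1 * (n%:R * (2 * C * (1 + b) + C * L * r0)) * `|z1 - z2|.
Proof.
move=> C0 L0 b0 N0 /andP[rp rr] H zb1 zb2.
have NR : 0 < N%:R :> R by rewrite ltr0n.
have r00 : 0 < r0 by lra.
have big z : ball c (r0 / 2) z -> ball c r0 z by apply: le_ball; lra.
have cin t z : ball c (r0 / 2) z -> ball c r0 (circle z r t).
  rewrite -!ball_normE /ball_/= /circle opprD addrA => zb.
  apply: le_lt_trans (ler_normB _ _) _; rewrite normrZ gtr0_norm//.
  have := norm_eit t; rewrite -(ler_pM2l rp); lra.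
rewrite /mean_deriv -scalerBr -sumrB normrZ (ger0_norm (ltW (_ : 0 < _^-1))) ?invr_gt0//.
rewrite ler_pdivrMl//; apply: le_trans (ler_norm_sum _ _ _) _.
set B := (X in _ <= _ * X).
have -> : N%:R * B = \sum_(k < N) B by rewrite sumr_const card_ord mulr_natl.
apply: ler_sum => k _; rewrite -!scalemxAr -scalerBr normrZ.
rewrite (ger0_norm (ltW (_ : 0 < _^-1))) ?invr_gt0// /B -!mulrA ler_pM2l ?invr_gt0//.
move: (node N k) => t.
set v1 := u (circle z1 r t) - u z1; set v2 := u (circle z2 r t) - u z2.
rewrite mulmxBB; apply: le_trans (ler_normD _ _) _.
have l1 : `|v1 - v2| <= 2 * C * `|z1 - z2|.
  have -> : v1 - v2 = (u (circle z1 r t) - u (circle z2 r t)) - (u z1 - u z2).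
    by rewrite /v1 /v2 opprD addrACA -opprD.
  apply: le_trans (ler_normB _ _) _.
  have := curve_lipschitz H (big _ zb2) (big _ zb1).
  have := curve_lipschitz H (cin t _ zb2) (cin t _ zb1).
  have -> : circle z1 r t - circle z2 r t = z1 - z2.
    by rewrite /circle opprD addrACA subrr addr0.
  lra.
have l2 : `|v2| <= C * r0.
  apply: le_trans (curve_lipschitz H (big _ zb2) (cin t _ zb2)) _.
  rewrite ler_wpM2l// /circle addrAC subrr add0r normrZ gtr0_norm//.
  apply: (@le_trans _ _ r); first by rewrite ler_piMr ?norm_eit// ltW.
  by clear -rr r00; lra.
have l3 : `|rotN (J (u z1)) t - rotN (J (u z2)) t| <= L * `|z1 - z2|.
  have -> : rotN (J (u z1)) t - rotN (J (u z2)) t = - (sin t *: (J (u z1)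
    - J (u z2))).
    by apply/matrixP => i j; rewrite !mxE; ring.
  rewrite normrN normrZ; apply: le_trans (cb_lip H (big _ zb1) (big _ zb2)).
  by rewrite ler_piMl// norm_sin.
have l4 : `|rotN (J (u z1)) t| <= 1 + b.
  by apply: le_trans (norm_rotN _ _) _; rewrite lerD2l;
    exact: (cb_norm H (big _ zb1)).
set d := `|z1 - z2| in l1 l3 *.
have -> : n%:R * ((2 * (C * (1 + b)) + C * (L * r0)) * d) =
   n%:R * (2 * C * d) * (1 + b) + n%:R * (C * r0) * (L * d) by ring.
apply: lerD; apply: le_trans (mulmx_norm_le _ _) _; apply: ler_pM => //;
  exact: ler_wpM2l.
Qed.

(** The derivative is within a multiple of [r] of the mean of radius [r]. So [r] is
    chosen first, according to [e], and then [d], according to the Lipschitz constant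
    of the mean of that radius; neither depends on the curve. *)
Lemma equicontinuous_dx (C L b r0 e : R) :
  0 <= C -> 0 <= L -> 0 <= b -> 0 < r0 -> 0 < e ->
  exists2 d, 0 < d & forall J c u, curve_bounds J C L b c r0 u ->
  forall z1 z2, ball c (r0 / 2) z1 -> ball c (r0 / 2) z2 -> `|z1 - z2| < d ->
  `|'d u z1 (1, 0) - 'd u z2 (1, 0)| <= e.
Proof.
move=> C0 L0 b0 r00 e0.
pose K : R := n%:R * (n%:R * C * L) * (1 + b).
have K0 : 0 <= K by rewrite /K !mulr_ge0// addr_ge0.
pose M : R := n%:R * (2 * C * (1 + b) + C * L * r0).
have M0 : 0 <= M by rewrite /M mulr_ge0// addr_ge0// !mulr_ge0// ?addr_ge0// ltW.
pose r := Num.min (r0 / 4) (e / 4 / (K + 1)).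
have rp : 0 < r by rewrite lt_min !divr_gt0// ltr_wpDl.
have rr0 : r <= r0 / 4 by rewrite ge_min lexx.
have Kr : K * r <= e / 4.
  apply: (@le_trans _ _ (K * (e / 4 / (K + 1)))).
    by rewrite ler_wpM2l// ge_min lexx orbT.
  by rewrite mulrCA ler_piMr ?divr_ge0 ?(ltW e0)// ler_pdivrMr ?mul1r ?lerDl// ltr_wpDl.
exists (r * (e / 4 / (M + 1))); first by rewrite mulr_gt0// !divr_gt0// ltr_wpDl.
move=> J c u H z1 z2 zb1 zb2 zd.
have sub z : ball c (r0 / 2) z -> curve_bounds J C L b z (r0 / 2) u.
  move=> zb; apply: curve_boundsW H => y; move: zb;
    rewrite -!ball_normE /ball_/= => h1 h2.
  by rewrite -(subrKA z); apply: le_lt_trans (ler_normD _ _) _; lra.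
have rr : 0 < r < r0 / 2 by rewrite rp/=; lra.
have e8 : 0 < e / 8 by rewrite divr_gt0.
have h2 : 0 < r0 / 2 by rewrite divr_gt0.
have [N1 H1] := mean_value_estimate (sub _ zb1) C0 L0 b0 h2 rr e8.
have [N2 H2] := mean_value_estimate (sub _ zb2) C0 L0 b0 h2 rr e8.
pose N := (maxn N1 N2).+1.
have := H1 N; rewrite ltnS leq_maxl => /(_ isT).
have := H2 N; rewrite ltnS leq_maxr => /(_ isT).
have := mean_deriv_dist C0 L0 b0 (isT : (0 < N)%N) rr H zb1 zb2.
rewrite -/M -/K.
move: (mean_deriv _ _ z1 _ _) (mean_deriv _ _ z2 _ _) => Q1 Q2 q12 q2 q1.
have q12' : r^-1 * M * `|z1 - z2| <= e / 4.
  rewrite -mulrA ler_pdivrMl//; apply: (@le_trans _ _ (M * (r * (e / 4 / (M + 1))))).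
    by rewrite ler_wpM2l// ltW.
  rewrite mulrCA ler_pM2l// mulrCA ler_piMr ?divr_ge0 ?(ltW e0)//.
  by rewrite ler_pdivrMr ?mul1r ?lerDl// ltr_wpDl.
have chain (D1 D2 : 'rV[R]_n) : `|Q1 - D1| <= K * r + e / 8 ->
    `|Q2 - D2| <= K * r + e / 8 -> `|D1 - D2| <= e.
  move=> h1 h3; have -> : D1 - D2 = - (Q1 - D1) + ((Q1 - Q2) + (Q2 - D2)).
    by rewrite subrKA opprB subrKA.
  apply: le_trans (ler_normD _ _) _; rewrite normrN.
  have := ler_normD (Q1 - Q2) (Q2 - D2); clear -h1 h3 q12 q12' Kr; lra.
exact: (chain _ _ q1 q2).
Qed.

Lemma diff_dx J C L b c r u z w : curve_bounds J C L b c r u -> ball c r z ->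
  'd u z w = w.1 *: 'd u z (1, 0) + w.2 *: ('d u z (1, 0) *m J (u z)).
Proof.
move=> H zb; have e1 : 'd u z (0, 1) = 'd u z (1, 0) *m J (u z).
  by rewrite -(cb_holo H zb) /mul_i/= oppr0.
by rewrite -e1; exact: diff_plane.
Qed.

Lemma equicontinuous_diff (C L b r0 e : R) :
  0 <= C -> 0 <= L -> 0 <= b -> 0 < r0 -> 0 < e ->
  exists2 d, 0 < d & forall J c u, curve_bounds J C L b c r0 u ->
  forall z1 z2, ball c (r0 / 2) z1 -> ball c (r0 / 2) z2 -> `|z1 - z2| < d ->
  forall w, `|'d u z1 w - 'd u z2 w| <= e * `|w|.
Proof.
move=> C0 L0 b0 r00 e0.
pose a : R := 1 + n%:R * b.
have a0 : 0 < a by rewrite /a ltr_wpDr// mulr_ge0.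
have a1 : 0 <= n%:R * C * L by rewrite !mulr_ge0.
have e1 : 0 < e / 2 / a by rewrite !divr_gt0.
have [d1 d10 Hd1] := equicontinuous_dx C0 L0 b0 r00 e1.
pose d2 := e / 2 / (n%:R * C * L + 1).
have d20 : 0 < d2 by rewrite !divr_gt0// ltr_wpDl.
exists (Num.min d1 d2); first by rewrite lt_min d10.
move=> J c u H z1 z2 zb1 zb2; rewrite lt_min => /andP[zd1 zd2] w.
have big z : ball c (r0 / 2) z -> ball c r0 z by apply: le_ball; lra.
have D12 := Hd1 J c u H z1 z2 zb1 zb2 zd1.
have s2 : `|'d u z2 (1, 0)| <= C.
  apply: le_trans (cb_speed H (big _ zb2) _) _.
  by rewrite ler_piMr//; apply: plane_norm_le; rewrite /= ?normr1 ?normr0.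
have j1 := cb_norm H (big _ zb1).
have j12 := cb_lip H (big _ zb1) (big _ zb2).
have E1 := diff_dx w H (big _ zb1); have E2 := diff_dx w H (big _ zb2).
suff gen (X1 X2 D1 D2 : 'rV[R]_n) (J1 J2 : 'M[R]_n) : `|D1 - D2| <= e / 2 / a ->
    `|D2| <= C -> `|J1| <= b -> `|J1 - J2| <= L * `|z1 - z2| ->
    X1 = w.1 *: D1 + w.2 *: (D1 *m J1) -> X2 = w.1 *: D2 + w.2 *: (D2 *m J2) ->
    `|X1 - X2| <= e * `|w|.
  exact: gen D12 s2 j1 j12 E1 E2.
move=> {}D12 {}s2 {}j1 {}j12 -> ->.
have -> : w.1 *: D1 + w.2 *: (D1 *m J1) - (w.1 *: D2 + w.2 *: (D2 *m J2)) =
    w.1 *: (D1 - D2) + w.2 *: ((D1 - D2) *m J1 + D2 *m (J1 - J2)).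
  by rewrite -mulmxBB !scalerBr opprD addrACA.
apply: le_trans (ler_normD _ _) _; rewrite !normrZ.
have q1 : `|w.1| * `|D1 - D2| <= `|w| * (e / 2 / a).
  by apply: ler_pM => //; exact: plane_norm_fst.
have q2 : `|(D1 - D2) *m J1 + D2 *m (J1 - J2)| <= n%:R * (e / 2 / a) * b + e / 2.
  apply: le_trans (ler_normD _ _) _; apply: lerD.
    apply: le_trans (mulmx_norm_le _ _) _; apply: ler_pM => //; exact: ler_wpM2l.
  apply: le_trans (mulmx_norm_le _ _) _.
  apply: (@le_trans _ _ (n%:R * C * (L * d2))).
    apply: ler_pM => //; first exact: ler_wpM2l.
    by apply: le_trans j12 _; rewrite ler_wpM2l// ltW.
  rewrite mulrA /d2 mulrCA ler_piMr ?divr_ge0 ?(ltW e0)//.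
  by rewrite ler_pdivrMr ?mul1r ?lerDl// ltr_wpDl.
have q3 : `|w.2| * `|(D1 - D2) *m J1 + D2 *m (J1 - J2)| <=
    `|w| * (n%:R * (e / 2 / a) * b + e / 2).
  by apply: ler_pM => //; exact: plane_norm_snd.
have -> : e * `|w| = `|w| * (e / 2 / a) + `|w| * (n%:R * (e / 2 / a) * b + e / 2).
  rewrite -mulrDr mulrC; congr (_ * _).
  have : e / 2 / a * a = e / 2 by rewrite divfK// gt_eqF.
  rewrite /a; move: (e / 2 / (1 + n%:R * b)) => x; lra.
exact: lerD.
Qed.

End Equicontinuity.

Section Limit.
Context {R : realType} {n : nat}.

Definition plane_lin (a b : 'rV[R]_n) (w : plane R) : 'rV[R]_n := w.1 *: a + w.2 *: b.

Lemma plane_lin_is_linear a b : linear (plane_lin a b).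
Proof.
move=> k w w'; rewrite /plane_lin /=; rewrite !scalerDl scalerDr addrACA !scalerA.
by [].
Qed.

HB.instance Definition _ a b :=
  GRing.isLinear.Build R (plane R) 'rV[R]_n _ (plane_lin a b)
    (plane_lin_is_linear a b).

Lemma continuous_plane_lin a b : continuous (plane_lin a b).
Proof.
move=> w; apply: cvgD; apply: cvgZl; [exact: cvg_fst|exact: cvg_snd].
Qed.

(** The first-order expansions of the [u k] hold with a common modulus, by
    [equicontinuous_diff], and are closed conditions: they pass to the limit at each
    pair of points separately. Hence pointwise convergence of the maps and of their
    first derivatives makes the limit differentiable, with continuous differential. *)
Lemma curve_limit (T : Type) (F : set_system T) (FF : ProperFilter F)
    (J : 'rV[R]_n -> 'M[R]_n) (C L b r0 : R) (c : plane R)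
    (u : T -> plane R -> 'rV[R]_n) (y D : plane R -> 'rV[R]_n) :
  0 <= C -> 0 <= L -> 0 <= b -> 0 < r0 ->
  (\forall k \near F, curve_bounds J C L b c r0 (u k)) ->
  (forall z, ball c r0 z -> u k z @[k --> F] --> y z) ->
  (forall z, ball c r0 z -> 'd (u k) z (1, 0) @[k --> F] --> D z) ->
  (forall z, ball c r0 z -> {for y z, continuous J}) ->
  forall z, ball c (r0 / 2) z ->
    is_diff z y (plane_lin (D z) (D z *m J (y z))) /\ {for z, continuous D}.
Proof.
move=> C0 L0 b0 r00 HF uy uD cJ.
have big z : ball c (r0 / 2) z -> ball c r0 z by apply: le_ball; lra.
have ud z w : ball c r0 z -> 'd (u k) z w @[k --> F] --> plane_lin (D z)
  (D z *m J (y z)) w.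
  move=> zb.
  have JJ : J (u k z) @[k --> F] --> J (y z) by exact: (cvg_comp _ _ (uy z zb)
    (cJ z zb)).
  have : w.1 *: 'd (u k) z (1, 0) + w.2 *: ('d (u k) z (1, 0) *m J (u k z)) @[k -->
    F] -->
      plane_lin (D z) (D z *m J (y z)) w.
    apply: cvgD; apply: cvgZr_tmp || apply: cvgZl_tmp.
      exact: uD.
    by apply: cvg_mulmx => //; exact: uD.
  apply: cvg_trans; apply: near_eq_cvg; near=> k.
  have Hk : curve_bounds J C L b c r0 (u k) by near: k.
  exact: esym (diff_dx w Hk zb).
move=> z zb; have zn := near_ball zb; split.
  apply: is_diff_eps; first exact: continuous_plane_lin.
  move=> e e0; have [d d0 Hd] := @equicontinuous_diff R n C L b r0 e C0 L0 b0 r00 e0.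
  have zd := nbhsx_ballx z _ d0.
  near=> z'.
  have zb' : ball c (r0 / 2) z' by near: z'; exact: zn.
  have zd' : `|z - z'| < d.
    have : ball z d z' by near: z'.
    by rewrite -ball_normE.
  apply: (@lim_norm_le R _ T F FF (fun k => u k z' - u k z - 'd (u k) z (z' - z))).
    by apply: cvgB; [apply: cvgB; apply: uy; exact: big|apply: ud; exact: big].
  apply: filterS HF => k Hk; apply: segment_growth => t t01.
  have tb := segment_ball zb zb' t01.
  split; first by apply: (cb_diff Hk); exact: big.
  apply: (Hd J c _ Hk _ _ tb zb).
  rewrite addrAC subrr add0r normrZ; apply: le_lt_trans zd'.
  case/andP: t01 => t0 t1; rewrite ger0_norm// distrC.
  by rewrite ler_piMl.
apply/cvgrPdist_le => e e0; have [d d0 Hd] :=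
  @equicontinuous_dx R n C L b r0 e C0 L0 b0 r00 e0.
have zd := nbhsx_ballx z _ d0.
near=> z'.
have zb' : ball c (r0 / 2) z' by near: z'; exact: zn.
have zd' : `|z - z'| < d.
  have : ball z d z' by near: z'.
  by rewrite -ball_normE.
apply: (@lim_norm_le R _ T F FF (fun k => 'd (u k) z (1, 0) - 'd (u k) z' (1, 0))).
  by apply: cvgB; apply: uD; exact: big.
by apply: filterS HF => k Hk; exact: (Hd J c _ Hk).
Unshelve. all: by end_near. Qed.

End Limit.

(** * Compactness *)

(** A local bound is a global one on a compact set, for a property [Q x c] that only
    gets weaker as [c] grows. *)
Lemma compact_bound (R : realType) (T : topologicalType) (K : set T)
    (Q : T -> R -> Prop) :
  compact K -> (forall x c c', Q x c -> c <= c' -> Q x c') ->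
  (forall x, K x -> exists c, \forall x' \near x, Q x' c) ->
  exists2 c, 0 <= c & forall x, K x -> Q x c.
Proof.
move=> /compact_near_coveringP cK mono loc.
have := cK R (pinfty_nbhs R) (fun c x => Q x c) _.
case=> [x Kx|c [_ Hc]].
  have [c Hc] := loc x Kx.
  exists ((fun x' => Q x' c), [set c' | c <= c']).
    by split => //; apply: nbhs_pinfty_ge; exact: num_real.
  by move=> [x' c'] /= [q cc]; exact: mono q cc.
pose d := Num.max 0 (c + 1); exists d; first by rewrite le_max lexx.
by move=> x Kx; apply: (Hc d) => //; rewrite lt_max ltrDl ltr01 orbT.
Qed.

Lemma near_eq_continuous (T U : topologicalType) (g h : T -> U) x :
  (\forall y \near x, g y = h y) -> {for x, continuous g} -> {for x, continuous h}.
Proof.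
move=> gh cg; have cg' : g y @[y --> x] --> h x by rewrite -(nbhs_singleton gh).
by apply: cvg_trans cg'; exact: near_eq_cvg.
Qed.

Lemma near_bound (R : realType) (T : topologicalType) (V : normedModType R)
    (f : T -> V) x : {for x, continuous f} ->
  exists c, \forall y \near x, `|f y| <= c.
Proof. by move=> cf; exists (`|f x| + 1); apply: (cvgr_norm_le _ cf);
  rewrite ltrDl. Qed.

(** Convergence along an ultrafilter replaces the extraction of subsequences: every
    sequence of maps into a compact space converges pointwise along it. *)
Lemma ultra_compact_cvg (I : Type) (T : topologicalType) (F : set_system I)
    (FU : UltraFilter F) (K : set T) (h : I -> T) :
  compact K -> (\forall i \near F, K (h i)) ->
  exists2 p, K p & h i @[i --> F] --> p.
Proof.
move=> cK FK; have [p [Kp clp]] := cK (h @ F) _ FK.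
exists p => // A pA.
have [//|FnA] := in_ultra_setVsetC (h @^-1` A) FU.
by have [q [nAq Aq]] := clp (~` A) A FnA pA.
Qed.

Lemma cvg_sum_ord (R : realType) (W : normedModType R) (T : Type)
    (F : set_system T) (FF : Filter F) n (g : 'I_n -> T -> W) (a : 'I_n -> W) :
  (forall i, g i t @[t --> F] --> a i) ->
  \sum_(i < n) g i t @[t --> F] --> \sum_(i < n) a i.
Proof.
move=> ga; apply: cvg_big => [|k _]; first exact: add_continuous.
exact: ga.
Qed.

Section OperatorBound.
Context {R : realType} {n : nat} {W : normedModType R}.
Implicit Types f : 'rV[R]_n -> W.

Definition diff_bound f x : R := \sum_(k < n) `|'d f x (delta_mx 0 k)|.

Lemma diff_rV f x w : 'd f x w = \sum_(k < n) w 0 k *: 'd f x (delta_mx 0 k).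
Proof.
rewrite [in LHS](row_sum_delta w) linear_sum.
by apply: eq_bigr => k _; rewrite linearZ.
Qed.

Lemma diff_boundP f x w : `|'d f x w| <= diff_bound f x * `|w|.
Proof.
rewrite (diff_rV f x w); apply: le_trans (ler_norm_sum _ _ _) _.
rewrite /diff_bound mulr_suml; apply: ler_sum => k _.
by rewrite normrZ mulrC ler_wpM2l// mx_entry_le.
Qed.

Lemma diff_bound_continuous f x :
  (forall w, {for x, continuous (fun y => 'd f y w)}) ->
  {for x, continuous (diff_bound f)}.
Proof.
move=> cf; apply: (@cvg_sum_ord R R _ (nbhs x)) => k.
by apply: cvg_norm; exact: cf.
Qed.

Lemma cvg_diff_rV (T : Type) (F : set_system T) (FF : Filter F) f
    (x w : T -> 'rV[R]_n) (x0 w0 : 'rV[R]_n) :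
  (forall v, 'd f (x t) v @[t --> F] --> 'd f x0 v) -> w t @[t --> F] --> w0 ->
  'd f (x t) (w t) @[t --> F] --> 'd f x0 w0.
Proof.
move=> cd cw.
have gen (D : 'rV[R]_n -> 'rV[R]_n -> W) :
    (forall y v, D y v = \sum_(k < n) v 0 k *: D y (delta_mx 0 k)) ->
    (forall v, D (x t) v @[t --> F] --> D x0 v) ->
    D (x t) (w t) @[t --> F] --> D x0 w0.
  move=> DE cD; rewrite DE; under eq_cvg do rewrite DE.
  apply: cvg_sum_ord => k; apply: cvgZ; last exact: cD.
  exact: (cvg_comp _ _ cw (@coord_continuous _ _ _ 0 k w0)).
exact: (gen (fun y v => 'd f y v) (diff_rV f) cd).
Qed.

End OperatorBound.

Section ClosedBall.
Context {R : realType} {n : nat}.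
Implicit Types x c : 'rV[R]_n.

Definition cball c (r : R) : set 'rV[R]_n := [set x | `|x - c| <= r].

Lemma cball_compact c r : compact (cball c r).
Proof.
apply: bounded_closed_compact.
  exists (r + `|c|); split; first exact: num_real.
  move=> M rM x /= xc; apply: le_trans (ltW rM).
  by rewrite -[x](subrK c); apply: le_trans (ler_normD _ _) _; rewrite lerD2r.
have -> : cball c r = (fun x => `|x - c|) @^-1` [set t | t <= r] by [].
apply: preimage_closed; last exact: (@closed_le R r).
move=> x _; apply: (@cvg_norm _ _ _ (nbhs x)).
by apply: (@cvgB _ _ _ (nbhs x)); [exact: cvg_id|exact: cvg_cst].
Qed.

Lemma cball_segment c r x y (t : R) :
  cball c r x -> cball c r y -> 0 <= t <= 1 -> cball c r (x + t *: (y - x)).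
Proof.
rewrite /cball/= => xr yr /andP[t0 t1].
have -> : x + t *: (y - x) - c = (1 - t) *: (x - c) + t *: (y - c).
  by apply/rowP => i; rewrite !mxE; ring.
apply: le_trans (ler_normD _ _) _; rewrite !normrZ ger0_norm ?subr_ge0//.
rewrite ger0_norm//.
have : (1 - t) * `|x - c| <= (1 - t) * r by rewrite ler_wpM2l ?subr_ge0.
have : t * `|y - c| <= t * r by rewrite ler_wpM2l.
lra.
Qed.

Lemma C1_bounds_cball (m p : nat) (f : 'rV[R]_n -> 'M[R]_(m, p)) c r :
  Ck 1 (cball c r) f ->
  exists b L, [/\ 0 <= b, 0 <= L, forall x, cball c r x -> `|f x| <= b &
    forall x y, cball c r x -> cball c r y -> `|f x - f y| <= L * `|x - y|].
Proof.
move=> [df cdf].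
have [b b0 Hb] : exists2 b, 0 <= b & forall x, cball c r x -> `|f x| <= b.
  apply: (compact_bound (Q := fun x d => `|f x| <= d) (@cball_compact c r)).
    by move=> x d d' h1 h2; exact: le_trans h1 h2.
  move=> x Kx; apply: near_bound; apply: differentiable_continuous; exact: df.
have [L L0 HL] : exists2 L, 0 <= L & forall x, cball c r x -> diff_bound f x <= L.
  apply: (compact_bound (Q := fun x d => diff_bound f x <= d) (@cball_compact c r)).
    by move=> x d d' h1 h2; exact: le_trans h1 h2.
  move=> x Kx; have cb : {for x, continuous (diff_bound f)}.
    by apply: diff_bound_continuous => w; exact: cdf.
  have [d Hd] := near_bound cb; exists d.
  by apply: filterS Hd => y; apply: le_trans; exact: ler_norm.
exists b, L; split => // x y xb yb.
rewrite -[f x - f y]subr0; apply: segment_growth => t t01.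
have tb := cball_segment yb xb t01.
split; first exact: df.
rewrite subr0; apply: le_trans (diff_boundP _ _ _) _.
by rewrite ler_wpM2r//; exact: HL.
Qed.

End ClosedBall.

(** * Change of charts *)
Section Charts.
Context {R : realType} {M : topologicalType} {n : nat} {X : manifold R M n}.
Implicit Types (i j : atlas_index X) (f : plane R -> M).

Let ch i : chart R M n := atlas i.

Lemma transition_C1 i j : Ck 1 (overlap (ch i) (ch j)) (transition (ch i) (ch j)).
Proof. exact: (atlas_smooth i j 1). Qed.

Lemma overlap_fwd i j p : dom (ch i) p -> dom (ch j) p ->
  overlap (ch i) (ch j) (fwd (ch i) p).
Proof. by move=> ip jp; split; [exact: fwd_cod|rewrite /= fwdK]. Qed.

Lemma near_dom (T : topologicalType) (f : T -> M) i z : {for z, continuous f} ->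
  dom (ch i) (f z) -> \forall y \near z, dom (ch i) (f y).
Proof.
by move=> cf di; apply: cf; apply: open_nbhs_nbhs; split => //; exact: dom_open.
Qed.

Lemma chart_change (V : normedModType R) (f : V -> M) i j z :
  {for z, continuous f} -> dom (ch i) (f z) -> dom (ch j) (f z) ->
  differentiable (fwd (ch i) \o f) z ->
  differentiable (fwd (ch j) \o f) z /\
  forall v, 'd (fwd (ch j) \o f) z v =
    'd (transition (ch i) (ch j)) (fwd (ch i) (f z)) ('d (fwd (ch i) \o f) z v).
Proof.
move=> cf di dj df.
have [dt _] := transition_C1 i j.
have dtz := dt _ (overlap_fwd di dj).
have dc := differentiable_comp df dtz.
have E : \forall y \near z, (transition (ch i) (ch j) \o (fwd (ch i) \o f)) y =
    (fwd (ch j) \o f) y.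
  apply: filterS (near_dom cf di) => y diy.
  by rewrite /transition /= fwdK.
have [d1 e1] := near_eq_diff E dc.
split; first exact: d1.
by move=> v; exact: (etrans (e1 v) (diff_compE v df dtz)).
Qed.

End Charts.

Section Holomorphic.
Context {R : realType} {M : topologicalType} {n k : nat} {X : manifold R M n}
  (J : almost_complex X k).
Implicit Types (i j : atlas_index X) (f : plane R -> M).

Let ch i : chart R M n := atlas i.

(** The equation needs to be checked in one chart around each point: transition
    maps are of class C^1 and intertwine the matrices of [J]. *)
Lemma J_holomorphic_of_charts (D : set (plane R)) f :
  (forall z, D z -> exists i, exists2 r, 0 < r &
    [/\ forall y, ball z r y -> {for y, continuous f} /\ dom (ch i) (f y),
        Ck 1 (ball z r) (fwd (ch i) \o f) &
        forall y, ball z r y -> forall v,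
          'd (fwd (ch i) \o f) y (mul_i v) =
          'd (fwd (ch i) \o f) y v *m acs J i (fwd (ch i) (f y))]) ->
  J_holomorphic J D f.
Proof.
move=> H; split=> [z Dz|j].
  by have [i [r r0 [h1 _ _]]] := H z Dz; have [] := h1 z (ballxx _ r0).
split; [split|].
- move=> z [Dz dj]; have [i [r r0 [h1 [h2 _] _]]] := H z Dz.
  have zz := ballxx z r0; have [cf di] := h1 z zz.
  by have [] := chart_change (j := j) cf di dj (h2 z zz).
- move=> v z [Dz dj]; have [i [r r0 [h1 [h2 h3] _]]] := H z Dz.
  have zz := ballxx z r0; have [cf di] := h1 z zz.
  have cy : {for z, continuous (fwd (ch i) \o f)}.
    exact: (differentiable_continuous (h2 z zz)).
  have [_ ct] := @transition_C1 R M n X i j.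
  have E : \forall y \near z, 'd (transition (ch i) (ch j)) ((fwd (ch i) \o f) y)
      ('d (fwd (ch i) \o f) y v) = 'd (fwd (ch j) \o f) y v.
    near=> y; have zy : ball z r y by near: y; exact: (near_ball zz).
    have [cfy diy] := h1 y zy.
    have djy : dom (ch j) (f y) by near: y; exact: (near_dom cf dj).
    by have [_ E] := chart_change (j := j) cfy diy djy (h2 y zy); exact: esym (E v).
  have := @cvg_diff_rV R n _ _ (nbhs z) _ (transition (ch i) (ch j))
    (fwd (ch i) \o f) (fun y => 'd (fwd (ch i) \o f) y v)
    (fwd (ch i) (f z)) ('d (fwd (ch i) \o f) z v) _ (h3 v z zz).
  move=> /(_ _ (fun w => cvg_comp _ _ cy (ct w _ (overlap_fwd di dj)))) lim.
  exact: (near_eq_continuous E lim).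
- move=> z Dz dj v; have [i [r r0 [h1 [h2 _] h4]]] := H z Dz.
  have zz := ballxx z r0; have [cf di] := h1 z zz.
  have [_ E] := chart_change (j := j) cf di dj (h2 z zz).
  have e1 := etrans (E (mul_i v)) (congr1 _ (h4 z zz v)).
  have e2 := acs_compat J (overlap_fwd di dj) ('d (fwd (ch i) \o f) z v).
  have e3 : transition (ch i) (ch j) (fwd (ch i) (f z)) = fwd (ch j) (f z).
    by rewrite /transition /= fwdK.
  apply: (etrans e1); apply: (etrans e2).
  by rewrite -/(ch i) -/(ch j) e3; congr (_ *m _); exact: esym (E v).
Unshelve. all: by end_near. Qed.

Definition affine (a : plane R) (s : R) (z : plane R) : plane R := a + s *: z.

Lemma is_diff_affine a s z : is_diff z (affine a s) ( *:%R s).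
Proof.
have := is_diffD (is_diff_cst a z) (is_diff_scaler s z).
by rewrite add0r.
Qed.

Lemma diff_affine (W : normedModType R) (g : plane R -> W) a s z :
  differentiable g (affine a s z) -> differentiable (g \o affine a s) z /\
  forall v, 'd (g \o affine a s) z v = s *: 'd g (affine a s z) v.
Proof.
move=> dg; have [da ea] := is_diff_affine a s z.
split; first exact: differentiable_comp.
move=> v; apply: (etrans (diff_compE v da dg)).
have ev : 'd (affine a s) z v = s *: v by exact: (congr1 (@^~ v) ea).
apply: (etrans (congr1 (fun w => 'd g (affine a s z) w) ev)).
exact: linearZ.
Qed.

Lemma J_holomorphic_affine (D D' : set (plane R)) f a s :
  open D -> J_holomorphic J D f -> (forall z, D' z -> D (affine a s z)) ->
  J_holomorphic J D' (f \o affine a s).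
Proof.
move=> oD [cf H] sub.
have ca z : {for z, continuous (affine a s)}.
  by have [da _] := is_diff_affine a s z; exact: differentiable_continuous.
split=> [z D'z|i].
  by apply: continuous_comp; [exact: ca|exact: cf (sub _ D'z)].
have [[h1 h2] h3] := H i; split; [split|].
- move=> z [/sub Dz di].
  by have [] := @diff_affine _ (fwd (atlas i) \o f) a s z (h1 _ (conj Dz di)).
- move=> v z [D'z di].
  have key : s *: 'd (fwd (atlas i) \o f) (affine a s y) v @[y --> z] -->
      s *: 'd (fwd (atlas i) \o f) (affine a s z) v.
    apply: cvgZl_tmp; exact: (cvg_comp _ _ (ca z) (h2 v _ (conj (sub _ D'z) di))).
  have E y : D (affine a s y) -> dom (atlas i) (f (affine a s y)) ->
      s *: 'd (fwd (atlas i) \o f) (affine a s y) v =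
      'd (fwd (atlas i) \o (f \o affine a s)) y v.
    move=> Dy dy.
    have [_ E] := @diff_affine _ (fwd (atlas i) \o f) a s y (h1 _ (conj Dy dy)).
    exact: esym (E v).
  have caf : {for z, continuous (f \o affine a s)}.
    by apply: continuous_comp; [exact: ca|exact: cf (sub _ D'z)].
  apply: (near_eq_continuous _ key); near=> y; apply: E.
    by near: y; apply: (ca z); apply: open_nbhs_nbhs; split => //; exact: sub.
  by near: y; exact: (near_dom caf di).
- move=> z /sub Dz di v.
  have [_ E] := @diff_affine _ (fwd (atlas i) \o f) a s z (h1 _ (conj Dz di)).
  apply: (etrans (E (mul_i v))); apply: (etrans (congr1 _ (h3 _ Dz di v))).
  apply: (etrans (scalemxAl _ _ _)); congr (_ *m _); exact: esym (E v).
Unshelve. all: by end_near. Qed.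

End Holomorphic.

(** * Boxes: balls in charts *)
Section Boxes.
Context {R : realType} {M : topologicalType} {n : nat} {X : manifold R M n}.
Hypothesis hausM : hausdorff_space M.

(** Such a set is compact, being the image of a closed ball. That it is closed in
    [M], and not only in the chart, is where the Hausdorff property enters. *)
Lemma chart_ball_closed (i : atlas_index X) (c : 'rV[R]_n) (r : R) :
  cball c r `<=` cod (atlas i) ->
  closed [set p | dom (atlas i) p /\ `|fwd (atlas i) p - c| <= r].
Proof.
move=> sub.
have -> : [set p | dom (atlas i) p /\ `|fwd (atlas i) p - c| <= r] =
    bwd (atlas i) @` cball c r.
  rewrite eqEsubset; split=> [p [dp pc]|p [x xc <-]].
    by exists (fwd (atlas i) p) => //; rewrite fwdK.
  split; first by apply: bwd_dom; exact: sub.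
  by rewrite bwdK//; exact: sub.
apply: compact_closed => //; apply: continuous_compact; last exact: cball_compact.
apply: continuous_in_subspaceT => x; rewrite inE => xc.
by apply: bwd_continuous; exact: sub.
Qed.

(** Two concentric balls in a chart, the core and the box of twice its radius. The
    cores cover [M]; a curve that starts in a core stays in the box, where the chart
    is defined, for a time controlled by its speed. *)
Record box := Box {
  bidx : atlas_index X;
  bctr : 'rV[R]_n;
  brad : R;
  brad_gt0 : 0 < brad;
  box_cod : cball bctr (2 * brad) `<=` cod (atlas bidx) }.

Definition bfwd (B : box) : M -> 'rV[R]_n := fwd (atlas (bidx B)).

Definition in_box (B : box) : set M :=
  [set p | dom (atlas (bidx B)) p /\ `|bfwd B p - bctr B| <= 2 * brad B].

Definition in_core (B : box) : set M :=
  [set p | dom (atlas (bidx B)) p /\ `|bfwd B p - bctr B| < brad B].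

Lemma in_box_closed B : closed (in_box B).
Proof. by apply: chart_ball_closed; exact: box_cod. Qed.

Lemma chart_open_ball i (c : 'rV[R]_n) (r : R) :
  open [set p | dom (atlas (m := X) i) p /\ `|fwd (atlas i) p - c| < r].
Proof.
rewrite openE => p [dp pr]; rewrite /interior.
have c1 : {for p, continuous (fun q => `|fwd (atlas i) q - c|)}.
  by apply: cvg_norm; apply: cvgB; [exact: fwd_continuous|exact: cvg_cst].
have h1 : \forall q \near p, dom (atlas i) q.
  by apply: open_nbhs_nbhs; split => //; exact: dom_open.
have h2 : \forall q \near p, `|fwd (atlas i) q - c| < r by exact: (cvgr_lt _ c1).
by apply: filterS2 h1 h2 => q.
Qed.

Lemma in_core_box B : in_core B `<=` in_box B.
Proof.
by move=> p [dp pr]; split=> //; apply: (le_trans (ltW pr)); have := brad_gt0 B; lra.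
Qed.

Lemma exists_box p : exists B : box, in_core B p.
Proof.
have [i di] := atlas_cover X p.
have : nbhs (fwd (atlas i) p) (cod (atlas i)).
  by apply: open_nbhs_nbhs; split; [exact: cod_open|exact: fwd_cod].
move=> /nbhs_normP[r /= r0 Hr].
have r3 : 0 < r / 3 by rewrite divr_gt0.
have sub : cball (fwd (atlas i) p) (2 * (r / 3)) `<=` cod (atlas i).
  move=> x; rewrite /cball/= => xr; apply: Hr; rewrite /= distrC.
  by apply: le_lt_trans xr _; lra.
exists (Box r3 sub); split=> //=.
by rewrite /bfwd/= subrr normr0.
Qed.

(** Compactness is used through near coverings, for the filter of large finite sets
    of points. *)
Lemma finite_boxes : compact [set: M] ->
  exists (I : finType) (B : I -> box), forall p, exists k, in_core (B k) p.
Proof.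
move=> cM.
pose bx (p : M) : box := projT1 (cid (exists_box p)).
have bxP p : in_core (bx p) p := projT2 (cid (exists_box p)).
pose F := filter_from [set: seq M] (fun s0 => [set s : seq M | {subset s0 <= s}]).
have FF : Filter F.
  apply: filter_from_filter; first by exists [::].
  move=> s s' _ _; exists (s ++ s') => // r /= sr.
  by split=> q qs; apply: sr; rewrite mem_cat qs ?orbT.
move/compact_near_coveringP : cM => cM.
have [p _|s _ Hs] := cM _ F (fun (s : seq M) p => exists2 q,
  q \in s & in_core (bx q) p) FF.
  exists (in_core (bx p), [set s : seq M | {subset [:: p] <= s}]).
    split; last by exists [:: p].
    by apply: open_nbhs_nbhs; split; [exact: chart_open_ball|exact: bxP].
  by move=> [q t] [/= qp ts]; exists p => //; apply: ts; rewrite inE.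
exists (seq_sub s), (fun q => bx (val q)) => p.
have [//|q qs pq] := Hs s (fun q h => h) p.
by exists (SeqSub qs).
Qed.

(** The differential of the transition map is bounded on the compact set of points
    common to both boxes. *)
Lemma box_change (B B' : box) : exists2 c, 0 <= c &
  forall (f : plane R -> M) z, {for z, continuous f} -> in_box B (f z) ->
  in_box B' (f z) -> differentiable (bfwd B \o f) z ->
  forall w, `|'d (bfwd B' \o f) z w| <= c * `|'d (bfwd B \o f) z w|.
Proof.
pose t := transition (atlas (bidx B)) (atlas (bidx B')).
have [dt ct] := @transition_C1 R M n X (bidx B) (bidx B').
have [c c0 Hc] : exists2 c, 0 <= c & forall x, cball (bctr B) (2 * brad B) x ->
    in_box B' (bwd (atlas (bidx B)) x) -> diff_bound t x <= c.
  apply: (compact_bound (Q := fun x d => in_box B' (bwd (atlas (bidx B)) x) ->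
    diff_bound t x <= d)); first exact: cball_compact.
    by move=> x d d' h1 h2 h3; exact: (le_trans (h1 h3) h2).
  move=> x xB; have xc := box_cod xB.
  have [xB'|xB'] := pselect (in_box B' (bwd (atlas (bidx B)) x)).
    have ox : overlap (atlas (bidx B)) (atlas (bidx B')) x by split=> //; case: xB'.
    have cb : {for x, continuous (diff_bound t)}.
      by apply: diff_bound_continuous => w; exact: ct.
    have [d Hd] := near_bound cb; exists d.
    by apply: filterS Hd => y h _; apply: le_trans h; exact: ler_norm.
  exists 0.
  have : \forall q \near bwd (atlas (bidx B)) x, ~ in_box B' q.
    apply: open_nbhs_nbhs; split=> //; apply: closed_openC; exact: in_box_closed.
  move=> /(bwd_continuous xc); move=> /= h; near=> y => yB'.
  have : ~ in_box B' (bwd (atlas (bidx B)) y) by near: y.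
  by [].
exists c => // f z cf [dB zB] [dB' zB'] df w.
have [_ E] := chart_change (j := bidx B') cf dB dB' df.
rewrite (le_trans _ (ler_wpM2r (normr_ge0 _) (Hc (bfwd B (f z)) zB _)))//.
  by apply: le_trans (diff_boundP _ _ _); rewrite -(E w).
by rewrite /bfwd fwdK.
Unshelve. all: by end_near. Qed.

(** A path whose velocity is known to be small only while it stays in the box never
    leaves it: up to the last time [T] before which it has stayed inside, it has moved
    by less than the distance to the boundary, so the exit cannot occur at [T]. *)
Lemma path_trap (B : box) (g : R -> M) (phi : R -> R) :
  (forall t, 0 <= t <= 1 -> {for t, continuous g}) ->
  dom (atlas (bidx B)) (g 0) ->
  `|bfwd B (g 0) - bctr B| + (phi 1 - phi 0) < 2 * brad B ->
  {within `[0, 1], continuous phi} ->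
  (forall t, 0 < t < 1 -> derivable phi t 1 /\ 0 <= 'D_1 phi t) ->
  (forall t, 0 < t < 1 -> in_box B (g t) -> derivable (bfwd B \o g) t 1 /\
     `|'D_1 (bfwd B \o g) t| <= 'D_1 phi t) ->
  in_box B (g 1) /\ `|bfwd B (g 1) - bfwd B (g 0)| <= phi 1 - phi 0.
Proof.
move=> cg d0 small cphi dphi dg.
pose U := [set p | dom (atlas (bidx B)) p /\ `|bfwd B p - bctr B| < 2 * brad B].
have oU : open U by exact: chart_open_ball.
have UB p : U p -> in_box B p by move=> [h1 h2]; split=> //; exact: ltW.
have phi_le t : 0 <= t <= 1 -> phi 0 <= phi t /\ phi t <= phi 1.
  move=> t01; have mono : {in `[0, 1]%R &, {homo phi : x y / x <= y}}.
    apply: ger0_derive1_le_cc => // x; rewrite in_itv/= => x01.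
      by have [] := dphi x x01.
    by rewrite derive1E; have [] := dphi x x01.
  by case/andP: (t01) => t0 t1; split; apply: mono; rewrite ?in_itv/= ?lexx ?ler01.
have phi10 : 0 <= phi 1 - phi 0 by rewrite subr_ge0; have [|] := phi_le 1;
  rewrite ?lexx ?ler01.
have U0 : U (g 0) by split=> //; move: small; lra.
have est t : 0 <= t <= 1 -> (forall s, 0 <= s <= t -> U (g s)) ->
    `|bfwd B (g t) - bfwd B (g 0)| <= phi t - phi 0.
  move=> /andP[t0 t1] Us.
  apply: (@growth_le R 0 t 1 n (bfwd B \o g) phi t0).
  - apply: continuous_in_subspaceT => s; rewrite inE/= in_itv/= => /andP[s0 st].
    apply: continuous_comp; first by apply: cg; rewrite s0 (le_trans st t1).
    by apply: fwd_continuous; have [] := Us s; rewrite ?s0.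
  - apply: continuous_subspaceW cphi => s; rewrite /= !in_itv/= => /andP[-> st].
    exact: le_trans st t1.
  - move=> s; rewrite in_itv/= => /andP[s0 st].
    have s01 : 0 < s < 1 by rewrite s0 (lt_le_trans st t1).
    have [p1 _] := dphi s s01.
    have [|q1 q2] := dg s s01; first by apply: UB; apply: Us; rewrite !ltW.
    by split.
(* [K] is closed and contained in the open box: this is what excludes an exit *)
pose K := [set p | dom (atlas (bidx B)) p /\
  `|fwd (atlas (bidx B)) p - bfwd B (g 0)| <= phi 1 - phi 0].
have subK : cball (bfwd B (g 0)) (phi 1 - phi 0) `<=` cod (atlas (bidx B)).
  move=> x; rewrite /cball/= => xk; apply: box_cod; rewrite /cball/=.
  rewrite -(subrKA (bfwd B (g 0))); apply: le_trans (ler_normD _ _) _.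
  by move: small xk; lra.
have cK : closed K by exact: chart_ball_closed.
have KU : K `<=` U.
  move=> p [h1 h2]; split=> //; rewrite -(subrKA (bfwd B (g 0))).
  apply: le_lt_trans (ler_normD _ _) _.
  by move: small h2; rewrite -/(bfwd B p); lra.
pose S := [set t | 0 <= t <= 1 /\ forall s, 0 <= s <= t -> U (g s)].
have S0 : S 0.
  by split; rewrite ?lexx ?ler01// => s s0; have -> : s = 0 by apply/eqP;
    rewrite eq_le andbC.
have SK t : S t -> K (g t).
  move=> [t01 Ut]; split; first by have [] := Ut t; rewrite // lexx andbT;
    case/andP: t01.
  by apply: le_trans (est t t01 Ut) _; rewrite lerD2r; have [] := phi_le t t01.
have hS : has_sup S by split; [exists 0|exists 1 => t [/andP[]]].
pose T := sup S.
have T0 : 0 <= T by apply: sup_upper_bound.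
have T1 : T <= 1 by apply: ge_sup; [exists 0|move=> t [/andP[]]].
have SltT t : 0 <= t -> t < T -> S t.
  move=> t0 tT; have e0 : 0 < T - t by rewrite subr_gt0.
  have [s [s01 Us] ts] := sup_adherent e0 hS.
  have {}ts : t < s by move: ts; rewrite -/T opprB addrCA subrr addr0.
  split; first by rewrite t0/=; apply: ltW (lt_le_trans tT T1).
  by move=> x /andP[x0 xt]; apply: Us; rewrite x0 (le_trans xt (ltW ts)).
have KT : K (g T).
  have [T00|Tn0] := eqVneq T 0; first by rewrite T00; exact: SK.
  have Tp : 0 < T by rewrite lt_def Tn0.
  have cT : g t @[t --> T^'-] --> g T.
    by apply: cvg_at_left_filter; apply: cg; rewrite T0.
  apply: (@closed_cvg _ _ (T^'-) _ g K cK _ _ cT); near=> t; apply: SK; apply: SltT.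
    by near: t; apply: nbhs_left_ge.
  by near: t; exact: nbhs_left_lt.
have ST : S T.
  split; first by rewrite T0.
  move=> s /andP[s0]; rewrite le_eqVlt => /predU1P[->|sT]; first exact: KU.
  have [_] := SltT s s0 sT; apply; by rewrite s0 lexx.
have TE : T = 1.
  apply/eqP; rewrite eq_le T1/= leNgt; apply/negP => Tlt.
  have : \forall t \near T, U (g t).
    by apply: (cg T); [rewrite T0|apply: open_nbhs_nbhs; split=> //; exact: KU].
  move=> /nbhs_normP[e /= e0 He].
  pose t := Num.min 1 (T + e / 2).
  have tT : T < t by rewrite lt_min Tlt ltrDl divr_gt0.
  have : S t.
    split; first by rewrite (le_trans T0 (ltW tT)) ge_min lexx.
    move=> s /andP[s0 st]; have [sT|Ts] := leP s T.
      by have [_] := ST; apply; rewrite s0.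
    apply: He => /=; rewrite distrC gtr0_norm ?subr_gt0//.
    have : t <= T + e / 2 by rewrite ge_min lexx orbT.
    by move: st e0; lra.
  by move=> /(sup_upper_bound hS); rewrite leNgt -/T tT.
move: ST; rewrite TE => -[h1 h2]; split; last exact: est.
by apply: UB; apply: h2; rewrite ler01 lexx.
Unshelve. all: by end_near. Qed.

End Boxes.

(** * The unit disk *)

Section Disk.
Context {R : realType}.
Implicit Types z w : plane R.

Lemma modulus_ge0 z : 0 <= modulus z.
Proof. exact: sqrtr_ge0. Qed.

Lemma modulus_sqr z : modulus z ^+ 2 = z.1 ^+ 2 + z.2 ^+ 2.
Proof. by rewrite sqr_sqrtr// addr_ge0 ?sqr_ge0. Qed.

Lemma norm_le_modulus z : `|z| <= modulus z.
Proof.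
apply: plane_norm_le; rewrite -(@ler_pXn2r _ 2) ?nnegrE ?modulus_ge0//.
  by rewrite modulus_sqr -normrX ger0_norm ?sqr_ge0// lerDl sqr_ge0.
by rewrite modulus_sqr -normrX ger0_norm ?sqr_ge0// lerDr sqr_ge0.
Qed.

Lemma modulusD z w : modulus (z + w) <= modulus z + modulus w.
Proof.
rewrite -(@ler_pXn2r _ 2) ?nnegrE ?modulus_ge0 ?addr_ge0 ?modulus_ge0//.
rewrite sqrrD !modulus_sqr /=.
suff : z.1 * w.1 + z.2 * w.2 <= modulus z * modulus w by rewrite mulr2n; nra.
have [le0|gt0] := leP (z.1 * w.1 + z.2 * w.2) 0.
  by apply: le_trans le0 _; rewrite mulr_ge0 ?modulus_ge0.
rewrite -(@ler_pXn2r _ 2) ?nnegrE ?mulr_ge0 ?modulus_ge0 ?(ltW gt0)//.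
rewrite exprMn !modulus_sqr.
have := sqr_ge0 (z.1 * w.2 - z.2 * w.1).
move: z.1 z.2 w.1 w.2 => a b c d; nra.
Qed.

Lemma modulusZ (s : R) z : modulus (s *: z) = `|s| * modulus z.
Proof.
rewrite /modulus /= /GRing.scale/= !exprMn -mulrDr sqrtrM ?sqr_ge0//.
by rewrite sqrtr_sqr.
Qed.

Lemma modulus_continuous : continuous (@modulus R).
Proof.
move=> z; apply: (@continuous_comp _ _ _ (fun z => z.1 ^+ 2 + z.2 ^+ 2) Num.sqrt).
  have cF (g : plane R -> R) : {for z, continuous g} -> {for z,
    continuous (fun y => g y ^+ 2)}.
    by move=> cg; rewrite /prop_for /continuous_at expr2; exact: (cvgM cg cg).
  by apply: cvgD; apply: cF; [exact: cvg_fst|exact: cvg_snd].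
exact: sqrt_continuous.
Qed.

Lemma disk_open : open (@disk R).
Proof.
rewrite (_ : @disk R = @modulus R @^-1` [set t | t < 1])//.
by apply: open_comp; [move=> z _; exact: modulus_continuous|exact: open_lt].
Qed.

Lemma norm_half_disk z : `|z| <= 1 / 2 -> disk z.
Proof.
move=> zh; rewrite /disk/= /modulus -[X in _ < X]sqrtr1 ltr_sqrt//.
have h1 := le_trans (plane_norm_fst z) zh.
have h2 := le_trans (plane_norm_snd z) zh.
move: h1 h2; rewrite !ler_norml => /andP[a1 a2] /andP[b1 b2].
move: z.1 z.2 a1 a2 b1 b2 => a b *; nra.
Qed.

Lemma disk_affine z w : disk z -> disk w -> disk (affine z (1 - modulus z) w).
Proof.
rewrite /disk/= /affine => z1 w1; apply: le_lt_trans (modulusD _ _) _.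
rewrite modulusZ gtr0_norm ?subr_gt0//.
have : (1 - modulus z) * modulus w < (1 - modulus z) * 1 by
  rewrite ltr_pM2l// subr_gt0.
lra.
Qed.

End Disk.

(** * Speed of maps into M and Brody's reparametrization *)
Section Speed.
Context {R : realType} {n : nat}.
Implicit Types y : plane R -> 'rV[R]_n.

Definition speed y z : R := `|'d y z (1, 0)| + `|'d y z (0, 1)|.

Lemma speed_ge0 y z : 0 <= speed y z.
Proof. by rewrite addr_ge0. Qed.

Lemma speedP y z w : `|'d y z w| <= speed y z * `|w|.
Proof.
suff gen (D D1 D2 : 'rV[R]_n) : D = w.1 *: D1 + w.2 *: D2 ->
    `|D| <= (`|D1| + `|D2|) * `|w| by exact: gen (diff_plane y z w).
move=> ->; apply: le_trans (ler_normD _ _) _; rewrite !normrZ mulrDl ![_ * `|w|]mulrC.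
by apply: lerD; rewrite ler_wpM2r// ?plane_norm_fst ?plane_norm_snd.
Qed.

Lemma speed_le y y' z z' c : (forall w, `|'d y' z' w| <= c * `|'d y z w|) ->
  speed y' z' <= c * speed y z.
Proof. by move=> H; rewrite /speed mulrDr; apply: lerD; exact: H. Qed.

Lemma speed_affine y a s z : differentiable y (affine a s z) ->
  speed (y \o affine a s) z = `|s| * speed y (affine a s z).
Proof.
move=> dy; have [_ E] := diff_affine dy.
rewrite /speed mulrDr; congr (_ + _).
  by rewrite -normrZ; congr (`|_|); exact: E.
by rewrite -normrZ; congr (`|_|); exact: E.
Qed.

Lemma speed_continuous y z : (forall w, {for z, continuous (fun x => 'd y x w)}) ->
  {for z, continuous (speed y)}.
Proof. by move=> cy; apply: cvgD; apply: cvg_norm; exact: cy. Qed.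

End Speed.

Section BoxedSpeed.
Context {R : realType} {M : topologicalType} {n : nat} {X : manifold R M n}.
Variables (J : almost_complex X 2) (I : finType) (B : I -> @box R M n X)
  (iota : M -> I)
  (lam : R).
Hypothesis iotaP : forall p, in_core (B (iota p)) p.
Hypothesis lam_ge1 : 1 <= lam.
Hypothesis lamP : forall k l (f : plane R -> M) z, {for z, continuous f} ->
  in_box (B k) (f z) -> in_box (B l) (f z) -> differentiable (bfwd (B k) \o f) z ->
  forall w, `|'d (bfwd (B l) \o f) z w| <= lam * `|'d (bfwd (B k) \o f) z w|.

(** The size of the differential at [z], read in the box selected by [iota] at the
    point [f z]. It is not continuous in [z], since [iota] is not, but another box
    around [f z] changes it by a factor at most [lam]. *)
Definition box_speed (f : plane R -> M) z : R := speed (bfwd (B (iota (f z))) \o f) z.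

Let lam0 : 0 <= lam. Proof. exact: le_trans ler01 lam_ge1. Qed.

Lemma J_holo_diff D f (b : @box R M n X) z : J_holomorphic J D f -> D z ->
  in_box b (f z) -> differentiable (bfwd b \o f) z.
Proof. by move=> [_ H] Dz [db _]; have [[h _] _] := H (bidx b); exact: h. Qed.

Lemma in_iota p : in_box (B (iota p)) p.
Proof. exact/in_core_box/iotaP. Qed.

Lemma speed_le_box_speed D f k z : J_holomorphic J D f -> D z -> in_box (B k) (f z) ->
  speed (bfwd (B k) \o f) z <= lam * box_speed f z.
Proof.
move=> Hf Dz kz; apply: speed_le; apply: lamP => //.
- by case: Hf => cf _; exact: cf.
- exact: in_iota.
- exact: (J_holo_diff Hf Dz (in_iota _)).
Qed.

Lemma box_speed_le_speed D f k z : J_holomorphic J D f -> D z -> in_box (B k) (f z) ->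
  box_speed f z <= lam * speed (bfwd (B k) \o f) z.
Proof.
move=> Hf Dz kz; apply: speed_le; apply: lamP => //.
- by case: Hf => cf _; exact: cf.
- exact: in_iota.
- exact: (J_holo_diff Hf Dz kz).
Qed.

Lemma box_speed_ge0 f z : 0 <= box_speed f z.
Proof. exact: speed_ge0. Qed.

Lemma box_speed_affine D f a s z : J_holomorphic J D f -> D (affine a s z) ->
  box_speed (f \o affine a s) z = `|s| * box_speed f (affine a s z).
Proof.
move=> Hf Dz; have df := J_holo_diff Hf Dz (in_iota _).
exact: (@speed_affine R n (bfwd (B (iota (f (affine a s z)))) \o f) a s z df).
Qed.

Lemma box_speed_locally_bounded D f z : open D -> J_holomorphic J D f -> D z ->
  exists c, \forall y \near z, box_speed f y <= c.
Proof.
move=> oD Hf Dz; pose k := iota (f z).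
have [cf H] := Hf; have [[_ h2] _] := H (bidx (B k)).
have [dk ck] := iotaP (f z).
have cs : {for z, continuous (speed (bfwd (B k) \o f))}.
  by apply: speed_continuous => w; exact: (h2 w z (conj Dz dk)).
have [c Hc] := near_bound cs; exists (lam * c).
have near_core : \forall y \near z, in_core (B k) (f y).
  by apply: (cf z Dz); apply: open_nbhs_nbhs; split;
    [exact: chart_open_ball|exact: iotaP].
have nD : \forall y \near z, D y by exact: open_nbhs_nbhs.
near=> y; have Dy : D y by near: y.
have ky : in_box (B k) (f y) by apply: in_core_box; near: y.
apply: le_trans (box_speed_le_speed Hf Dy ky) _; apply: ler_wpM2l => //.
by apply: le_trans (ler_norm _) _; near: y.
Unshelve. all: by end_near. Qed.

(** The speed is bounded on the ball of radius [1 / 2], so [(1 / 2 - |z|) * speed]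
    has there a finite supremum [s], which is large if the speed at 0 is. At a point
    [z0] where half of [s] is exceeded, the speed is at most four times its value [N]
    at [z0] on the ball of radius [r / 2], where [r = 1 / 2 - |z0|]; rescaling by [N]
    turns this ball into one of radius [r * N / 2], more than [s / 4]. *)
Lemma brody_reparametrization :
  (forall K, exists2 f, J_holomorphic J (@disk R) f & K < box_speed f 0) ->
  forall k : nat, exists f, [/\ J_holomorphic J (ball 0 k.+1%:R) f,
    box_speed f 0 = 1 &
    forall z, ball 0 k.+1%:R z -> box_speed f z <= 4].
Proof.
have arith (r N s m : R) : s / 2 < r * N -> r / 2 * m <= s -> r * m <= r * (N * 4).
  by lra.
move=> H k; have [f Hf f0] := H (8 * k.+1%:R).
pose K := [set z : plane R | `|z| <= 1 / 2].
have cK : compact K.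
  have -> : K = (`[- (1 / 2), 1 / 2]%classic `*` `[- (1 / 2), 1 / 2]%classic).
    rewrite eqEsubset; split=> z; rewrite /K/= !in_itv/= -!ler_norml.
      move=> zh; split; apply: le_trans zh;
        [exact: plane_norm_fst|exact: plane_norm_snd].
    by move=> [h1 h2]; exact: plane_norm_le.
  by apply: compact_setX; exact: segment_compact.
have Kd z : K z -> disk z by exact: norm_half_disk.
have [c c0 Hc] : exists2 c, 0 <= c & forall z, K z -> box_speed f z <= c.
  apply: (compact_bound (Q := fun z d => box_speed f z <= d) cK).
    by move=> x d d' h1 h2; exact: le_trans h1 h2.
  by move=> z Kz; apply: (box_speed_locally_bounded disk_open Hf); exact: Kd.
pose g z := (1 / 2 - `|z|) * box_speed f z.
pose S := [set g z | z in K].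
have K0 : K 0 by rewrite /K/= normr0 divr_ge0.
have hS : has_sup S.
  split; first by exists (g 0); exists 0.
  exists (1 / 2 * c) => _ [z Kz <-]; rewrite /g.
  apply: ler_pM; rewrite ?subr_ge0 ?box_speed_ge0 ?Hc//.
  by rewrite lerBlDr lerDl.
pose s := sup S.
have s0 : 4 * k.+1%:R < s.
  apply: (@lt_le_trans _ _ (g 0)); last by apply: sup_upper_bound => //; exists 0.
  by rewrite /g normr0 subr0; move: f0; lra.
have k0 : 0 < k.+1%:R :> R by rewrite ltr0n.
have sp : 0 < s by apply: lt_trans s0; rewrite mulr_gt0.
have [_ [z0 Kz0 <-]] := sup_adherent (divr_gt0 sp (ltr0n R 2)) hS.
rewrite -/s => sg.
pose r := 1 / 2 - `|z0|; pose N := box_speed f z0.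
have gE : g z0 = r * N by [].
have r0 : 0 <= r by rewrite subr_ge0.
have N0 : 0 <= N by exact: box_speed_ge0.
have gp : s / 2 < r * N by move: sg; rewrite gE; lra.
have rN : 0 < r * N by apply: lt_trans gp; rewrite divr_gt0.
have Np : 0 < N by rewrite lt_def N0 andbT; apply: contraTneq rN => ->;
  rewrite mulr0 ltxx.
have ball_r z : ball 0 k.+1%:R z -> `|affine z0 N^-1 z - z0| < r / 2.
  rewrite -ball_normE /ball_/= sub0r normrN => zk.
  rewrite /affine addrAC subrr add0r normrZ gtr0_norm ?invr_gt0//.
  by rewrite ltr_pdivrMl//; apply: lt_trans zk _; move: gp s0; lra.
have in_K z : ball 0 k.+1%:R z ->
    K (affine z0 N^-1 z) /\ r / 2 <= 1 / 2 - `|affine z0 N^-1 z|.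
  move=> /ball_r; move: (affine z0 N^-1 z) => w wr.
  have := ler_normD (w - z0) z0; rewrite subrK /K/= => h.
  by split; move: wr h r0; rewrite /r; lra.
exists (f \o affine z0 N^-1); split.
- apply: J_holomorphic_affine disk_open Hf _ => z zb; apply: Kd.
  by have [] := in_K z zb.
- have z00 : affine z0 N^-1 0 = z0 by rewrite /affine scaler0 addr0.
  rewrite (box_speed_affine Hf) z00; last exact: Kd.
  by rewrite gtr0_norm ?invr_gt0// mulVf// gt_eqF.
- move=> z zb; have [Kz rz] := in_K z zb.
  rewrite (box_speed_affine Hf); last exact: Kd.
  rewrite gtr0_norm ?invr_gt0// ler_pdivrMl//.
  have gs : g (affine z0 N^-1 z) <= s := sup_upper_bound hS (imageP g Kz).
  have : r / 2 * box_speed f (affine z0 N^-1 z) <= s.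
    exact: (le_trans (ler_wpM2r (box_speed_ge0 f (affine z0 N^-1 z)) rz) gs).
  have rp : 0 < r by rewrite lt_def r0 andbT; apply: contraTneq rN => ->;
    rewrite mul0r ltxx.
  move: gp; move: (box_speed f _) => m gp h.
  by have := arith _ _ _ _ gp h; rewrite ler_pM2l.
Qed.

(** The affine map sending 0 to [z] and the disk into itself has factor
    [1 - modulus z], which is at least half of [1 - modulus z ^+ 2]. *)
Lemma box_speed_disk_bound K f z : 0 <= K ->
  (forall h, J_holomorphic J (@disk R) h -> box_speed h 0 <= K) ->
  J_holomorphic J (@disk R) f -> disk z -> box_speed f z * (1 - modulus z ^+ 2)
    <= 2 * K.
Proof.
move=> K0 HK Hf dz.
have z1 : 0 < 1 - modulus z by rewrite subr_gt0.
have Hh : J_holomorphic J (@disk R) (f \o affine z (1 - modulus z)).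
  by apply: J_holomorphic_affine disk_open Hf _ => w; exact: disk_affine.
have z00 : affine z (1 - modulus z) 0 = z by rewrite /affine scaler0 addr0.
have := HK _ Hh; rewrite (box_speed_affine Hf) z00// gtr0_norm//.
have := box_speed_ge0 f z; have := modulus_ge0 z.
move: (box_speed f z) (modulus z) z1 => m a a1 a0 m0 h.
have : (1 - a) * m * (1 + a) <= K * (1 + a) by rewrite ler_wpM2r// addr_ge0.
nra.
Qed.

End BoxedSpeed.

(** * Lobachevski length *)

Section HyperbolicLength.
Context {R : realType}.
Implicit Types (a b : plane R) (g : R -> plane R).
Local Notation mu := (@lebesgue_measure R).

Definition hyp_density g (t : R) : R := modulus (derive1 g t) / (1 - modulus (g t)
  ^+ 2).

Lemma disk_sqr_lt1 (z : plane R) : disk z -> 0 < 1 - modulus z ^+ 2.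
Proof.
rewrite /disk/= => z1; have z0 := modulus_ge0 z.
rewrite subr_gt0 expr2; move: (modulus z) z0 z1 => m *; nra.
Qed.

Lemma disk_path_diff a b g t : disk_path a b g -> differentiable g t.
Proof. by move=> [[dg _] _ _ _]; exact: dg. Qed.

Lemma disk_path_continuous a b g t : disk_path a b g -> {for t, continuous g}.
Proof. by move=> gp; apply: differentiable_continuous; exact: disk_path_diff gp. Qed.

Lemma hyp_density_ge0 a b g t : disk_path a b g -> 0 <= t <= 1 ->
  0 <= hyp_density g t.
Proof.
move=> [_ _ _ gd] t01; rewrite divr_ge0 ?modulus_ge0//.
by apply: ltW; apply: disk_sqr_lt1; exact: gd.
Qed.

Lemma hyp_density_continuous a b g t : disk_path a b g -> 0 <= t <= 1 ->
  {for t, continuous (hyp_density g)}.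
Proof.
move=> gp t01; have [[dg cdg] _ _ gd] := gp.
have cm : {for t, continuous (fun s => modulus (derive1 g s))}.
  rewrite (_ : derive1 g = fun s => 'd g s 1); last first.
    by rewrite funeqE => s; apply: derive1E'; exact: dg.
  by apply: continuous_comp; [exact: cdg|exact: modulus_continuous].
have cg : {for t, continuous (fun s => modulus (g s))}.
  by apply: continuous_comp; [exact: disk_path_continuous gp|exact: modulus_continuous].
apply: cvgM; first exact: cm.
apply: cvgV; first by rewrite gt_eqF// disk_sqr_lt1//; exact: gd.
apply: cvgB; first exact: cvg_cst.
rewrite expr2; under eq_cvg do rewrite expr2.
exact: (cvgM cg cg).
Qed.

Lemma hyp_density_within a b g : disk_path a b g ->
  {within `[0, 1], continuous (hyp_density g)}.
Proof.
move=> gp; apply: continuous_in_subspaceT => t; rewrite inE/= in_itv/= => t01.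
exact: hyp_density_continuous gp t01.
Qed.

Lemma hyp_density_integrable a b g : disk_path a b g ->
  mu.-integrable `[0, 1] (EFin \o hyp_density g).
Proof.
move=> gp; apply: continuous_compact_integrable; first exact: segment_compact.
exact: hyp_density_within gp.
Qed.

Lemma hyp_lengthE a b g : disk_path a b g ->
  hyp_length g = (parameterized_integral mu 0 1 (hyp_density g))%:E.
Proof.
move=> gp; rewrite /parameterized_integral /Rintegral fineK//.
by apply: integrable_fin_num => //; exact: hyp_density_integrable gp.
Qed.

Lemma hyp_length_ge0 a b g : disk_path a b g -> (0 <= hyp_length g)%E.
Proof.
move=> gp; apply: integral_ge0 => t /=; rewrite in_itv/= => t01.
by rewrite lee_fin; exact: (hyp_density_ge0 gp t01).
Qed.

Lemma rho_ge0 a b : (0 <= rho a b)%E.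
Proof. by apply: le_ereal_inf_tmp => _ [g gp <-]; exact: hyp_length_ge0 gp. Qed.

Lemma hyp_length_primitive a b g (A : R) : disk_path a b g -> 0 <= A ->
  exists phi : R -> R, [/\ {within `[0, 1], continuous phi},
    (phi 1 - phi 0)%:E = (A%:E * hyp_length g)%E &
    forall t, 0 < t < 1 -> derivable phi t 1 /\ 'D_1 phi t = A * hyp_density g t].
Proof.
move=> gp A0; have ig := hyp_density_integrable gp.
pose P t := parameterized_integral mu 0 t (hyp_density g).
have cP : {within `[0, 1], continuous P} by apply: parameterized_integral_continuous.
exists (fun t => A * P t); split.
- by move=> t; apply: cvgM; [exact: cvg_cst|exact: cP].
- rewrite (hyp_lengthE gp) -EFinM -mulrBr; congr (A * _)%:E.
  by rewrite /P {2}/parameterized_integral set_itv1 Rintegral_set1 subr0.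
- move=> t /andP[t0 t1].
  have t01 : 0 <= t <= 1 by rewrite !ltW.
  have [dP eP] := @continuous_FTC1_closed R (hyp_density g) 0 t 1 t1 ig t0
    (hyp_density_continuous gp t01).
  split; first by apply: derivableM => //; exact: derivable_cst.
  have -> : 'D_1 (fun t => A * P t) t = 'D_1 (A \*: (P : R -> R^o)) t by [].
  by rewrite deriveZ// -derive1E eP.
Qed.

Lemma segment_path a b : (forall t, 0 <= t <= 1 -> disk (a + t *: (b - a))) ->
  disk_path a b (fun t => a + t *: (b - a)).
Proof.
move=> H; split.
- split=> [t _|v t _].
    by apply/derivable1_diffP; have [] := is_derive_line a (b - a) t.
  rewrite (_ : (fun x => 'd (fun s : R => a + s *: (b - a)) x v) = fun=>
    v *: (b - a)).
    exact: cvg_cst.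
  rewrite funeqE => x; have [d e] := is_derive_line a (b - a) x.
  by rewrite (deriv1E d) derive1E e.
- by rewrite scale0r addr0.
- by rewrite scale1r addrC subrK.
- exact: H.
Qed.

(** On the disk of radius [1 / 2] the density is at most [2]: compare with the
    segment. *)
Lemma rho_small a b : modulus a <= 1 / 4 -> modulus (b - a) <= 1 / 4 ->
  (rho a b <= (2 * modulus (b - a))%:E)%E.
Proof.
move=> a4 ba4; pose g := fun t : R => a + t *: (b - a).
have gm t : 0 <= t <= 1 -> modulus (g t) <= 1 / 2.
  move=> /andP[t0 t1]; apply: le_trans (modulusD _ _) _.
  rewrite modulusZ ger0_norm//.
  have : t * modulus (b - a) <= 1 * modulus (b - a) by
    rewrite ler_wpM2r// modulus_ge0.
  by move: a4 ba4; lra.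
have gp : disk_path a b g.
  apply: segment_path => t t01; rewrite /disk/=; apply: le_lt_trans (gm t t01) _; lra.
apply: (@le_trans _ _ (hyp_length g)); first by apply: ereal_inf_lbound; exists g.
have dg t : derive1 g t = b - a.
  by have [d e] := is_derive_line a (b - a) t; rewrite derive1E e.
have le t : 0 <= t <= 1 -> hyp_density g t <= 2 * modulus (b - a).
  move=> t01; rewrite /hyp_density dg mulrC; apply: ler_wpM2r;
    first exact: modulus_ge0.
  have g2 : modulus (g t) ^+ 2 <= 1 / 4.
    have := gm t t01; have := modulus_ge0 (g t); rewrite expr2.
    move: (modulus _) => m *; nra.
  rewrite -[2]invrK lef_pV2 ?posrE ?invr_gt0//; first by lra.
  by lra.
have -> : (2 * modulus (b - a))%:E = (\int[mu]_(t in `[0%R, 1%R])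
  (2 * modulus (b - a))%:E)%E.
  by rewrite integral_cst//= lebesgue_measure_itv/= lte_fin ltr01 oppr0 adde0 mule1.
apply: ge0_le_integral => //=.
- by move=> t; rewrite in_itv/= => t01; rewrite lee_fin;
    exact: (hyp_density_ge0 gp t01).
- by have /integrableP[] := hyp_density_integrable gp.
Qed.

End HyperbolicLength.

(** * Bounded speed implies hyperbolicity *)
Section KobayashiBound.
Context {R : realType} {M : topologicalType} {n : nat} {X : manifold R M n}.
Variables (J : almost_complex X 2) (I : finType) (B : I -> @box R M n X)
  (iota : M -> I)
  (lam : R).
Hypothesis hausM : hausdorff_space M.
Hypothesis iotaP : forall p, in_core (B (iota p)) p.
Hypothesis lam_ge1 : 1 <= lam.
Hypothesis lamP : forall k l (f : plane R -> M) z, {for z, continuous f} ->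
  in_box (B k) (f z) -> in_box (B l) (f z) -> differentiable (bfwd (B k) \o f) z ->
  forall w, `|'d (bfwd (B l) \o f) z w| <= lam * `|'d (bfwd (B k) \o f) z w|.
Variable K : R.
Hypothesis K0 : 0 <= K.
Hypothesis HK : forall h, J_holomorphic J (@disk R) h -> box_speed B iota h 0 <= K.

Let A : R := lam * (2 * K).

Let A0 : 0 <= A.
Proof. by rewrite !mulr_ge0// (le_trans ler01 lam_ge1). Qed.

(** The bound [2 * K / (1 - modulus z ^+ 2)] on the speed of a disk is a multiple of
    the Lobachevski density, so the image of a path in a chart is at most [A] times as
    long as the path. *)
Lemma path_bound k f a b g (l : R) : J_holomorphic J (@disk R) f -> disk_path a b g ->
  hyp_length g = l%:E -> dom (atlas (bidx (B k))) (f a) ->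
  `|bfwd (B k) (f a) - bctr (B k)| + A * l < 2 * brad (B k) ->
  in_box (B k) (f b) /\ `|bfwd (B k) (f b) - bfwd (B k) (f a)| <= A * l.
Proof.
move=> Hf gp gl da small; have [_ g0 g1 gd] := gp; have [cf Hfd] := Hf.
have [phi [cphi phi10 dphi]] := hyp_length_primitive gp A0.
have {}phi10 : phi 1 - phi 0 = A * l by apply: EFin_inj; rewrite phi10 gl EFinM.
rewrite -g0 -g1 -phi10; apply: (@path_trap R M n X hausM (B k) (f \o g) phi) => //=.
- move=> t t01; apply: continuous_comp; first exact: disk_path_continuous gp.
  by apply: cf; exact: gd.
- by rewrite g0.
- by rewrite g0 phi10.
- move=> t t01; have [h1 h2] := dphi t t01; split; first exact: h1.
  rewrite h2 mulr_ge0// (hyp_density_ge0 gp)//.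
  by case/andP: t01 => h3 h4; rewrite !ltW.
- move=> t t01 inb.
  have t01' : 0 <= t <= 1 by case/andP: t01 => h3 h4; rewrite !ltW.
  have dgt : differentiable g t by exact: disk_path_diff gp.
  have dt := gd t t01'.
  have df := J_holo_diff Hf dt inb.
  have ig : is_derive t (1 : R) g (derive1 g t).
    by rewrite derive1E; apply: derivableP; exact: diff_derivable.
  have [d1 e1] := is_derive_comp ig df.
  split; first exact: d1.
  have [_ ->] := dphi t t01.
  have -> : 'D_1 (bfwd (B k) \o (f \o g)) t = 'd (bfwd (B k) \o f) (g t)
    (derive1 g t).
    exact: e1.
  apply: le_trans (speedP _ _ _) _.
  have s1 := speed_le_box_speed iotaP lamP Hf dt inb.
  have s2 := box_speed_disk_bound iotaP K0 HK Hf dt.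
  have m1 := disk_sqr_lt1 dt.
  have nm := norm_le_modulus (derive1 g t).
  have sp0 := speed_ge0 (bfwd (B k) \o f) (g t).
  rewrite /hyp_density mulrA ler_pdivlMr//.
  have lam0 : 0 <= lam by exact: le_trans ler01 lam_ge1.
  have s3 : speed (bfwd (B k) \o f) (g t) * (1 - modulus (g t) ^+ 2) <= A.
    apply: (@le_trans _ _ (lam * (box_speed B iota f (g t) * (1 - modulus (g t)
      ^+ 2)))).
      by rewrite mulrA ler_wpM2r// ltW.
    by rewrite ler_wpM2l.
  rewrite mulrAC; apply: ler_pM => //.
  by rewrite mulr_ge0// ltW.
Qed.

(** Infimum of [path_bound] over all paths; the strict inequality leaves a gap in
    which almost minimal paths fit. *)
Lemma disk_bound k f a b (r : R) : J_holomorphic J (@disk R) f ->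
  rho a b = r%:E -> dom (atlas (bidx (B k))) (f a) ->
  `|bfwd (B k) (f a) - bctr (B k)| + A * r < 2 * brad (B k) ->
  in_box (B k) (f b) /\ `|bfwd (B k) (f b) - bfwd (B k) (f a)| <= A * r.
Proof.
move=> Hf rr da small.
pose gap := 2 * brad (B k) - (`|bfwd (B k) (f a) - bctr (B k)| + A * r).
have gap0 : 0 < gap by rewrite subr_gt0.
have A1 : 0 < A + 1 by rewrite ltr_wpDl.
have key e : 0 < e -> e <= gap / 2 ->
    in_box (B k) (f b) /\ `|bfwd (B k) (f b) - bfwd (B k) (f a)| <= A * r + e.
  move=> e0 eg.
  have : (rho a b < (r + e / (A + 1))%:E)%E.
    by rewrite rr lte_fin ltrDl divr_gt0.
  move=> /ereal_inf_lt[_ /= [g gp <-]]; rewrite (hyp_lengthE gp) lte_fin.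
  set l := parameterized_integral _ _ _ _ => lr.
  have Al : A * l <= A * r + e.
    apply: (@le_trans _ _ (A * (r + e / (A + 1)))); first by rewrite ler_wpM2l// ltW.
    rewrite mulrDr lerD2l mulrCA ler_piMr ?(ltW e0)//.
    by rewrite ler_pdivrMr// mul1r lerDl.
  have [|h1 h2] := path_bound Hf gp (hyp_lengthE gp) da.
    by move: Al eg gap0; rewrite -/l /gap; lra.
  by split=> //; exact: le_trans h2 Al.
have g2 : 0 < gap / 2 by rewrite divr_gt0.
split; first by have [] := key (gap / 2) g2 (lexx _).
apply/ler_addgt0Pr => e e0.
have [||_] := key (Num.min e (gap / 2)).
- by rewrite lt_min e0.
- by rewrite ge_min lexx orbT.
- by move/le_trans; apply; rewrite lerD2l ge_min lexx.
Qed.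

(** All the links of a short chain starting at [p] stay in one and the same box, so
    their displacements add up in one chart. *)
Lemma chain_bound p m (s : nat -> M) (a b : nat -> plane R) (f : nat -> plane R -> M)
    (r : nat -> R) :
  s 0%N = p ->
  (forall i, (i < m)%N -> [/\ J_holomorphic J (@disk R) (f i), f i (a i) = s i,
     f i (b i) = s i.+1, rho (a i) (b i) = (r i)%:E & 0 <= r i]) ->
  A * (\sum_(i < m) r i) < brad (B (iota p)) ->
  dom (atlas (bidx (B (iota p)))) (s m) /\
  `|bfwd (B (iota p)) (s m) - bfwd (B (iota p)) p| <= A * (\sum_(i < m) r i).
Proof.
move=> s0; elim: m => [|m IH] H small.
  by rewrite big_ord0 mulr0 s0 subrr normr0; split=> //; have [] := iotaP p.
have [Hf fa fb rr r0] := H m (ltnSn m).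
move: small; rewrite big_ord_recr/= mulrDr => small.
have Ar : 0 <= A * r m by rewrite mulr_ge0.
have [||dm sm] := IH.
- by move=> i im; apply: H; exact: ltnW.
- by apply: le_lt_trans small; rewrite lerDl.
have [_ pc] := iotaP p.
have [|| [db _] h] := disk_bound Hf rr (k := iota p).
- by rewrite fa.
- rewrite fa -(subrKA (bfwd (B (iota p)) p)).
  have := ler_normD (bfwd (B (iota p)) (s m) - bfwd (B (iota p)) p)
    (bfwd (B (iota p)) p - bctr (B (iota p))).
  by move: sm small pc; lra.
split; first by rewrite -fb.
rewrite -(subrKA (bfwd (B (iota p)) (s m))); apply: le_trans (ler_normD _ _) _.
by rewrite addrC; apply: lerD => //; rewrite -fa -fb.
Qed.

Lemma bounded_speed_hyperbolic : hyperbolic J.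
Proof.
move=> p q pq0.
have r0 := brad_gt0 (B (iota p)).
have A1 : 0 < A + 1 by rewrite ltr_wpDl.
have key e : 0 < e -> e <= brad (B (iota p)) ->
    dom (atlas (bidx (B (iota p)))) q /\
    `|bfwd (B (iota p)) q - bfwd (B (iota p)) p| <= e.
  move=> e0 er.
  have : (kobayashi J p q < (e / (A + 1))%:E)%E by rewrite pq0 lte_fin divr_gt0.
  move=> /ereal_inf_lt[_ /= [m [s [a [b [f [m1 [s0 sm H] ->]]]]]]] sumlt.
  have fin i : (i < m)%N -> rho (a i) (b i) \is a fin_num.
    move=> im; rewrite ge0_fin_numE ?rho_ge0//.
    apply: (@le_lt_trans _ _ (\sum_(i < m) rho (a i) (b i))%E).
      rewrite (bigD1 (Ordinal im))//= leeDl// sume_ge0// => j _; exact: rho_ge0.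
    by apply: lt_trans sumlt _; rewrite ltry.
  pose r i := fine (rho (a i) (b i)).
  have sumE : (\sum_(i < m) rho (a i) (b i) = (\sum_(i < m) r i)%:E)%E.
    by rewrite -sumEFin; apply: eq_bigr => i _; rewrite fineK// fin.
  have As : A * (\sum_(i < m) r i) < e.
    move: sumlt; rewrite sumE lte_fin ltr_pdivlMr// mulrDr mulr1 => h.
    have rs : 0 <= \sum_(i < m) r i by apply: sumr_ge0 => i _;
      exact: fine_ge0 (rho_ge0 _ _).
    by move: h rs; rewrite mulrC; lra.
  have [||h1 h2] := @chain_bound p m s a b f r s0.
  - move=> i im; have [_ _ h3 h4 h5] := H i im; split=> //; first by
      rewrite fineK// fin.
    exact: fine_ge0 (rho_ge0 _ _).
  - exact: lt_le_trans As er.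
  by rewrite -sm; split=> //; apply: le_trans h2 (ltW As).
have [dq _] := key _ r0 (lexx _).
have [dp _] := iotaP p.
rewrite -(fwdK dp) -(fwdK dq); congr (bwd _ _); apply/esym/eqP.
rewrite -subr_eq0 -normr_le0; apply/ler_addgt0Pr => e e0; rewrite add0r.
have [||_] := key (Num.min e (brad (B (iota p)))).
- by rewrite lt_min e0.
- by rewrite ge_min lexx orbT.
- by move/le_trans; apply; rewrite ge_min lexx.
Qed.

End KobayashiBound.

(** * Complex lines kill the pseudo-distance *)
Section LineDegenerate.
Context {R : realType} {M : topologicalType} {n k : nat} {X : manifold R M n}
  (J : almost_complex X k).

Lemma kobayashi_ge0 p q : (0 <= kobayashi J p q)%E.
Proof.
apply: le_ereal_inf_tmp => _ [m [s [a [b [f [_ _ ->]]]]]].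
by apply: sume_ge0 => i _; exact: rho_ge0.
Qed.

Lemma kobayashi_line f z w : J_holomorphic J [set: plane R] f ->
  kobayashi J (f z) (f w) = 0%E.
Proof.
move=> Hf; apply/eqP; rewrite eq_le kobayashi_ge0 andbT.
apply/lee_addgt0Pr => e e0; rewrite add0e.
pose L := 1 + modulus z + modulus (w - z).
have L1 : 1 <= L by rewrite /L -addrA lerDl addr_ge0 ?modulus_ge0.
pose s := 4 * L + 2 * L / e.
have L0 : 0 < L by exact: lt_le_trans ltr01 L1.
have sL : 4 * L <= s by rewrite lerDl divr_ge0 ?mulr_ge0 ?ltW.
have s0 : 0 < s by apply: lt_le_trans sL; rewrite mulr_gt0.
have se : 2 * L <= e * s.
  have -> : e * s = e * (4 * L) + 2 * L by rewrite /s; field; rewrite gt_eqF.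
  by rewrite lerDr !mulr_ge0// ltW.
have zL : modulus z <= L by rewrite /L addrAC lerDr addr_ge0 ?modulus_ge0.
have wL : modulus (w - z) <= L by rewrite /L lerDr addr_ge0 ?modulus_ge0.
pose a := s^-1 *: z; pose b := s^-1 *: w.
have am : modulus a <= 1 / 4.
  rewrite modulusZ gtr0_norm ?invr_gt0// ler_pdivrMl//.
  by apply: le_trans zL _; move: sL; clear; lra.
have ba : b - a = s^-1 *: (w - z) by rewrite scalerBr.
have bm : modulus (b - a) <= 1 / 4.
  rewrite ba modulusZ gtr0_norm ?invr_gt0// ler_pdivrMl//.
  by apply: le_trans wL _; move: sL; clear; lra.
have da : disk a by rewrite /disk/=; apply: le_lt_trans am _; lra.
have db : disk b.
  rewrite /disk/= -[b](subrK a); apply: le_lt_trans (modulusD _ _) _.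
  by move: am bm; clear; lra.
have rs : (rho a b <= e%:E)%E.
  apply: le_trans (rho_small am bm) _; rewrite lee_fin ba modulusZ.
  rewrite gtr0_norm ?invr_gt0// mulrCA ler_pdivrMl// [s * e]mulrC.
  by apply: le_trans se; rewrite ler_pM2l.
apply: le_trans rs; apply: ereal_inf_lbound.
pose g := f \o affine 0 s.
have aff x : affine 0 s (s^-1 *: x) = x.
  by rewrite /affine add0r scalerA mulfV ?scale1r// gt_eqF.
exists 1%N, (fun i => if i is 0%N then f z else f w), (fun=> a), (fun=> b), (fun=> g).
split=> //; last by rewrite big_ord_recr big_ord0/= add0e.
split=> // -[|//] _; split=> //.
- by apply: J_holomorphic_affine openT Hf _.
- by rewrite /g /= aff.
- by rewrite /g /= aff.
Qed.

End LineDegenerate.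

(** * The limit of rescaled disks *)

Section LimitLine.
Context {R : realType} {M : topologicalType} {n : nat} {X : manifold R M n}.
Variables (J : almost_complex X 2) (I : finType) (B : I -> @box R M n X)
  (iota : M -> I)
  (lam : R).
Hypothesis hausM : hausdorff_space M.
Hypothesis iotaP : forall p, in_core (B (iota p)) p.
Hypothesis lam_ge1 : 1 <= lam.
Hypothesis lamP : forall k l (f : plane R -> M) z, {for z, continuous f} ->
  in_box (B k) (f z) -> in_box (B l) (f z) -> differentiable (bfwd (B k) \o f) z ->
  forall w, `|'d (bfwd (B l) \o f) z w| <= lam * `|'d (bfwd (B k) \o f) z w|.
Variables (c0 : R) (h : nat -> plane R -> M).
Hypothesis c0_ge0 : 0 <= c0.
Hypothesis hJ : forall k, J_holomorphic J (ball 0 k.+1%:R) (h k).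
Hypothesis h0 : forall k, box_speed B iota (h k) 0 = 1.
Hypothesis hC : forall k z, ball 0 k.+1%:R z -> box_speed B iota (h k) z <= c0.

Let lam0 : 0 < lam. Proof. exact: lt_le_trans ltr01 lam_ge1. Qed.
Let C := lam * c0.
Let C0 : 0 <= C. Proof. by rewrite mulr_ge0// ltW. Qed.

Lemma acs_C1 (b : @box R M n X) : Ck 1 (cball (bctr b) (2 * brad b)) (acs J (bidx b)).
Proof.
have [dJ cJ] := acs_Ck J (bidx b); split=> [x /box_cod xc|v x /box_cod xc].
  exact: dJ.
have [dv _] := cJ v; exact: (differentiable_continuous (dv x xc)).
Qed.

(** [J] and its Lipschitz constant are bounded on a box, so a bound on the speed is
    all that a curve in the box has to satisfy. *)
Lemma box_curve_bounds (b : @box R M n X) : exists b' L, [/\ 0 <= b', 0 <= L &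
  forall D f c r s, J_holomorphic J D f -> ball c r `<=` D -> 0 <= s ->
    (forall z, ball c r z -> in_box b (f z)) ->
    (forall z, ball c r z -> speed (bfwd b \o f) z <= s) ->
    curve_bounds (acs J (bidx b)) s (L * s) b' c r (bfwd b \o f)].
Proof.
have [b' [L [b0 L0 Hb HL]]] := C1_bounds_cball (acs_C1 b).
exists b', L; split=> // D f c r s Hf sub s0 inb sp.
have [cf H] := Hf; have [[h1 h2] h3] := H (bidx b).
have DD z : ball c r z -> (D `&` f @^-1` dom (atlas (bidx b))) z.
  by move=> zb; split; [exact: sub|have [] := inb z zb].
have bd z : ball c r z -> forall w, `|'d (bfwd b \o f) z w| <= s * `|w|.
  move=> zb w; apply: le_trans (speedP _ _ _) _; apply: ler_wpM2r => //; exact: sp.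
split.
- by move=> z /DD; exact: h1.
- by move=> w z /DD zD; exact: (h2 w z zD).
- by move=> z zb w; have [zD dz] := DD z zb; exact: (h3 z zD dz w).
- exact: bd.
- move=> z z' zb zb'; apply: (le_trans (HL _ _ (inb z zb).2 (inb z' zb').2)).
  rewrite -mulrA; apply: ler_wpM2l => //.
  rewrite -[X in `|X|]subr0; apply: (@segment_growth R _ _ _ (bfwd b \o f)) => t t01.
  have tb := segment_ball zb' zb t01.
  by split; [exact: (h1 _ (DD _ tb))|rewrite subr0; exact: bd].
- move=> z zb; apply: acs_sq; apply: box_cod; exact: (inb z zb).2.
- by move=> z zb; apply: Hb; exact: (inb z zb).2.
Qed.

Lemma stay_in_box k z0 (b : I) d : ball z0 d `<=` ball 0 k.+1%:R -> in_core (B b)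
  (h k z0) ->
  C * d <= brad (B b) -> forall z, ball z0 d z -> in_box (B b) (h k z).
Proof.
move=> sub [d0 core] Cd z zd.
have dp : 0 < d by move: zd; rewrite -ball_normE /ball_/=; exact: le_lt_trans.
have z0d : ball z0 d z0 by exact: ballxx.
pose l (t : R) := z0 + t *: (z - z0).
have lin t : 0 <= t <= 1 -> ball z0 d (l t) by exact: segment_ball.
have l0 : l 0 = z0 by rewrite /l scale0r addr0.
have l1 : l 1 = z by rewrite /l scale1r addrC subrK.
have [cf _] := hJ k.
pose phi (t : R) := 0 + t *: (C * `|z - z0| : R^o).
have dphi (t : R) : is_derive t (1 : R) phi (C * `|z - z0|) by exact: is_derive_line.
have nz : `|z - z0| < d by move: zd; rewrite -ball_normE /ball_/= distrC.
have dl t : is_derive t (1 : R) l (z - z0) by exact: is_derive_line.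
have [||||||inb1 _] := @path_trap R M n X hausM (B b) (h k \o l) phi.
- move=> t t01; apply: continuous_comp.
    by apply: differentiable_continuous; apply/derivable1_diffP; have [] := dl t.
  by apply: cf; apply: sub; exact: lin.
- by rewrite /= l0.
- rewrite /= l0 /phi scale1r scale0r !add0r subr0.
  have : C * `|z - z0| <= C * d by rewrite ler_wpM2l// ltW.
  by move: core Cd; lra.
- apply: derivable_within_continuous => t _; by have [] := dphi t.
- move=> t _; have [d1 ->] := dphi t; split; first exact: d1.
  by rewrite mulr_ge0.
- move=> t /andP[t0 t1] inb.
  have t01 : 0 <= t <= 1 by rewrite !ltW.
  have lD := sub _ (lin t t01).
  have df := J_holo_diff (hJ k) lD inb.
  have [d1 e1] := is_derive_comp (dl t) df.
  split; first exact: d1.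
  have [_ ->] := dphi t.
  have -> : 'D_1 (bfwd (B b) \o (h k \o l)) t = 'd (bfwd (B b) \o h k) (l t) (z - z0).
    exact: e1.
  apply: le_trans (speedP _ _ _) _; apply: ler_wpM2r => //.
  apply: le_trans (speed_le_box_speed iotaP lamP (hJ k) lD inb) _.
  by apply: ler_wpM2l; [exact: ltW|exact: hC].
- by move: inb1; rewrite /= l1.
Qed.

Variable F : set_system nat.
Hypothesis FU : UltraFilter F.
Hypothesis Finf : \oo `<=` F.

Variable f : plane R -> M.
Hypothesis hf : forall z, h k z @[k --> F] --> f z.

(** On a ball around [z0] of size independent of [k], almost all the maps [h k]
    take values in one box and satisfy there the hypotheses of [curve_limit]. *)
Lemma limit_local z0 (b := B (iota (f z0))) : exists2 d, 0 < d &
  exists D : plane R -> 'rV[R]_n,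
  [/\ forall z, ball z0 d z -> in_box b (f z),
      forall z, ball z0 d z ->
        is_diff z (bfwd b \o f)
          (plane_lin (D z) (D z *m acs J (bidx b) (bfwd b (f z)))) /\
        {for z, continuous D} &
      'd (bfwd b \o h k) z0 (1, 0) @[k --> F] --> D z0 /\
      exists b', \forall k \near F, curve_bounds (acs J (bidx b))
        C b' b' z0 d (bfwd b \o h k)].
Proof.
have FF : ProperFilter F by exact: (@ultra_proper _ F FU).
have [b' [L [b0 L0 HB]]] := box_curve_bounds b.
have rb := brad_gt0 b.
pose d := Num.min 1 (brad b / (C + 1)).
have C1 : 0 < C + 1 by rewrite ltr_wpDl.
have d0 : 0 < d by rewrite lt_min ltr01 divr_gt0.
have d1 : d <= 1 by rewrite ge_min lexx.
have Cd : C * d <= brad b.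
  apply: (@le_trans _ _ (C * (brad b / (C + 1)))).
    by rewrite ler_wpM2l// ge_min lexx orbT.
  by rewrite mulrCA ler_piMr ?(ltW rb)// ler_pdivrMr// mul1r lerDl.
have core : \forall k \near F, in_core b (h k z0).
  by apply: hf; apply: open_nbhs_nbhs; split; [exact: chart_open_ball|exact: iotaP].
have large : \forall k \near F, ball z0 d `<=` ball 0 k.+1%:R.
  apply: Finf; exists (Num.bound (`|z0| + 1)) => // k /= bk z.
  rewrite -!ball_normE /ball_/= sub0r normrN => zd.
  have : `|z0| + 1 < k.+1%:R.
    apply: (@lt_le_trans _ _ (Num.bound (`|z0| + 1))%:R); first by
      apply: archi_boundP; rewrite addr_ge0.
    by rewrite ler_nat; exact: (leq_trans bk).
  have := ler_normD (z - z0) z0; rewrite subrK distrC.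
  by move: zd d1; lra.
have inb : \forall k \near F, forall z, ball z0 d z -> in_box b (h k z).
  near=> k; apply: stay_in_box; [near: k; exact: large|near: k;
    exact: core|exact: Cd].
have cb : \forall k \near F, curve_bounds (acs J (bidx b)) C (L * C)
  b' z0 d (bfwd b \o h k).
  near=> k; have sub : ball z0 d `<=` ball 0 k.+1%:R by near: k; exact: large.
  have ink : forall z, ball z0 d z -> in_box b (h k z) by near: k; exact: inb.
  apply: (HB _ _ z0 d C (hJ k) sub C0 ink) => z zd.
  apply: le_trans (speed_le_box_speed iotaP lamP (hJ k) (sub z zd) (ink z zd)) _.
  by apply: ler_wpM2l; [exact: ltW|apply: hC; exact: sub].
have fin z : ball z0 d z -> in_box b (f z).
  move=> zd; have cl : closed (in_box b) by exact: in_box_closed.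
  have hz : \forall k \near F, in_box b (h k z) by apply: filterS inb => k; exact.
  exact: (@closed_cvg _ _ F FF (fun k => h k z) (in_box b) cl hz (f z) (@hf z)).
have [D HD] : exists D : plane R -> 'rV[R]_n, forall z, ball z0 d z ->
    'd (bfwd b \o h k) z (1, 0) @[k --> F] --> D z.
  suff /choice[D HD] : forall z, exists p : 'rV[R]_n, ball z0 d z ->
    'd (bfwd b \o h k) z (1, 0) @[k --> F] --> p by exists D.
  move=> z; have [zd|nzd] := pselect (ball z0 d z); last by exists 0.
  have [|p _ Hp] := ultra_compact_cvg FU (h := fun k => 'd (bfwd b \o h k) z (1, 0))
    (@cball_compact R n 0 C).
    apply: filterS cb => k Hk; rewrite /cball/= subr0.
    apply: le_trans (cb_speed Hk zd _) _.
    by rewrite ler_piMr//; apply: plane_norm_le; rewrite /= ?normr1 ?normr0.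
  by exists p.
exists (d / 2); first by rewrite divr_gt0.
have half z : ball z0 (d / 2) z -> ball z0 d z by apply: le_ball;
  rewrite ler_pdivrMr//; lra.
exists D; split.
- by move=> z /half; exact: fin.
- apply: (@curve_limit R n nat F FF (acs J (bidx b)) C (L * C) b' d z0
    (fun k => bfwd b \o h k) (bfwd b \o f) D) => //.
  + by rewrite mulr_ge0.
  + move=> z zd; apply: (cvg_comp _ _ (@hf z)).
    by apply: fwd_continuous; exact: (fin z zd).1.
  + move=> z zd; apply: (differentiable_continuous ((acs_C1 b).1 _ _)).
    exact: (fin z zd).2.
- split; first by apply: HD; exact: ballxx.
  exists (Num.max (L * C) b'); apply: filterS cb => k Hk.
  have [g1 g2 g3 g4 g5 g6 g7] := curve_boundsW (fun z => @half z) Hk; split => //.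
  + move=> z z' zb zb'; apply: le_trans (g5 z z' zb zb') _.
    by apply: ler_wpM2r => //; rewrite le_max lexx.
  + by move=> z zb; apply: le_trans (g7 z zb) _; rewrite le_max lexx orbT.
Unshelve. all: by end_near. Qed.

Lemma limit_holomorphic : J_holomorphic J [set: plane R] f.
Proof.
apply: J_holomorphic_of_charts => z0 _.
pose b := B (iota (f z0)).
have [d d0 [D [inb HD _]]] := limit_local z0.
exists (bidx b), d => //.
have dy z : ball z0 d z -> differentiable (bfwd b \o f) z by move=> zd; have [[]]
  := HD z zd.
have Ey z v : ball z0 d z -> 'd (bfwd b \o f) z v =
    plane_lin (D z) (D z *m acs J (bidx b) (bfwd b (f z))) v.
  by move=> zd; have [[_ e] _] := HD z zd; exact: (congr1 (@^~ v) e).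
split.
- move=> z zd; have [dz cz] := inb z zd; split=> //.
  have cy : {for z, continuous (bwd (atlas (bidx b)) \o (bfwd b \o f))}.
    apply: continuous_comp; first by apply: differentiable_continuous; exact: dy.
    by apply: bwd_continuous; exact: box_cod.
  apply: (near_eq_continuous _ cy); near=> y.
  have yd : ball z0 d y by near: y; exact: (near_ball zd).
  by have [dy' _] := inb y yd; rewrite /= /bfwd fwdK.
- split=> [z zd|v z zd]; first exact: dy.
  have cy : {for z, continuous (bfwd b \o f)}.
    by apply: differentiable_continuous; exact: dy.
  have cJ : {for z, continuous (fun y => acs J (bidx b) (bfwd b (f y)))}.
    apply: (cvg_comp _ _ cy); apply: (differentiable_continuous ((acs_C1 b).1 _ _)).
    exact: (inb z zd).2.
  have cD : {for z, continuous D} by have [] := HD z zd.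
  have key : {for z, continuous
      (fun y => plane_lin (D y) (D y *m acs J (bidx b) (bfwd b (f y))) v)}.
    by apply: cvgD; apply: cvgZl_tmp; [exact: cD|exact: cvg_mulmx cD cJ].
  apply: (near_eq_continuous _ key); near=> y; apply/esym; apply: Ey.
  by near: y; exact: (near_ball zd).
- move=> z zd v; apply: (etrans (Ey z (mul_i v) zd)).
  rewrite (_ : 'd (fwd (atlas (bidx b)) \o f) z v = plane_lin (D z)
    (D z *m acs J (bidx b) (bfwd b (f z))) v).
    rewrite /plane_lin /mul_i /= mulmxDl -!scalemxAl -mulmxA acs_sq; last first.
      by apply: box_cod; exact: (inb z zd).2.
    by rewrite mulmxN mulmx1 scalerN scaleNr addrC.
  exact: Ey.
Unshelve. all: by end_near. Qed.

(** By the equation, the speed at 0 is controlled by the derivative in the first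
    direction. For a constant limit these derivatives tend to 0, while the speeds of
    the [h k] at 0 are all 1. *)
Lemma limit_nonconstant : exists z w, f z <> f w.
Proof.
have FF : ProperFilter F by exact: (@ultra_proper _ F FU).
apply: contrapT => const.
have {}const z w : f z = f w by apply: contrapT => zw; apply: const; exists z, w.
have [d d0 [D [inb HD [limD [b' cb]]]]] := limit_local 0.
set b := B (iota (f 0)) in inb HD limD cb.
have z0 : ball 0 d (0 : plane R) by exact: ballxx.
have D0 : D 0 = 0.
  have [[_ e] _] := HD 0 z0.
  have ef : bfwd b \o f = cst (bfwd b (f 0)).
    by rewrite funeqE => z; rewrite /= (const z 0).
  have : plane_lin (D 0) (D 0 *m acs J (bidx b) (bfwd b (f 0))) (1, 0) = 0.
    apply: (etrans (esym (congr1 (@^~ (1, 0)) e))).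
    have cE : \forall z \near (0 : plane R), cst (bfwd b (f 0)) z = (bfwd b \o f) z.
      by apply: (@filterS _ (nbhs (0 : plane R)) _ setT) => [z _|];
        [rewrite ef|exact: filterT].
    have [_ E] := near_eq_diff cE (differentiable_cst _ _).
    apply: (etrans (E (1, 0))).
    exact: (congr1 (@^~ ((1, 0) : plane R)) (diff_cst (bfwd b (f 0)) (0 : plane R))).
  by rewrite /plane_lin/= scale1r scale0r addr0.
have bp : 0 <= n%:R * Num.max 0 b' by rewrite mulr_ge0// le_max lexx.
pose e := (2 * (lam * (1 + n%:R * Num.max 0 b')))^-1.
have e0 : 0 < e by rewrite invr_gt0 !mulr_gt0// ltr_wpDr.
have core : \forall k \near F, in_core b (h k 0).
  by apply: hf; apply: open_nbhs_nbhs; split; [exact: chart_open_ball|exact: iotaP].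
have small : \forall k \near F, `|'d (bfwd b \o h k) 0 (1, 0)| < e.
  by apply: (cvgr_norm_lt _ limD); rewrite D0 normr0.
have [k [[kc ks] kb]] := @filter_ex _ F _ _ (filterI (filterI core small) cb).
have kin : ball 0 k.+1%:R (0 : plane R) by apply: ballxx.
have := box_speed_le_speed iotaP lamP (hJ k) kin (in_core_box kc).
rewrite h0 /speed.
have e01 : 'd (bfwd b \o h k) 0 (0, 1) =
    'd (bfwd b \o h k) 0 (1, 0) *m acs J (bidx b) ((bfwd b \o h k) 0).
  by rewrite -(cb_holo kb z0) /mul_i/= oppr0.
have nJ := cb_norm kb z0.
suff gen (D1 D2 : 'rV[R]_n) (Jm : 'M[R]_n) : `|D1| < e -> `|Jm| <= b' ->
  D2 = D1 *m Jm ->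
    ~ (1 <= lam * (`|D1| + `|D2|)) by exact: gen ks nJ e01.
move=> D1e Jb ->; apply/negP; rewrite -ltNge.
have : `|D1 *m Jm| <= n%:R * `|D1| * Num.max 0 b'.
  apply: le_trans (mulmx_norm_le _ _) _; apply: ler_wpM2l; first by rewrite mulr_ge0.
  by rewrite le_max Jb orbT.
move=> le2; apply: (@le_lt_trans _ _ (lam * (1 + n%:R * Num.max 0 b') * `|D1|)).
  rewrite -mulrA; apply: ler_wpM2l; first exact: ltW.
  by rewrite mulrDl mul1r lerD2l mulrAC.
have cp : 0 < lam * (1 + n%:R * Num.max 0 b') by rewrite mulr_gt0// ltr_wpDr.
apply: (@lt_trans _ _ (lam * (1 + n%:R * Num.max 0 b') * e)); first by
  rewrite ltr_pM2l.
rewrite /e invfM mulrCA mulfV ?mulr1 ?gt_eqF//; lra.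
Qed.

End LimitLine.

(** * The main theorem *)
Section FiniteAtlas.
Context {R : realType} {M : topologicalType} {n : nat} {X : manifold R M n}.

(** Finitely many boxes with covering cores, a choice [iota] of a core around each
    point, and a common bound [lam] for the changes of box. *)
Lemma box_system : hausdorff_space M -> compact [set: M] ->
  exists (I : finType) (B : I -> @box R M n X) (iota : M -> I) (lam : R),
  [/\ forall p, in_core (B (iota p)) p, 1 <= lam &
    forall k l (f : plane R -> M) z, {for z, continuous f} ->
      in_box (B k) (f z) -> in_box (B l) (f z) -> differentiable (bfwd (B k) \o f)
        z ->
      forall w, `|'d (bfwd (B l) \o f) z w| <= lam * `|'d (bfwd (B k) \o f) z w|].
Proof.
move=> hausM cM; have [I [B covB]] := @finite_boxes R M n X cM.
have [iota iotaP] := choice covB.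
have [c Hc] : exists c : I -> I -> R, forall k l, 0 <= c k l /\
    forall (f : plane R -> M) z, {for z, continuous f} ->
      in_box (B k) (f z) -> in_box (B l) (f z) -> differentiable (bfwd (B k) \o f)
        z ->
      forall w, `|'d (bfwd (B l) \o f) z w| <= c k l * `|'d (bfwd (B k) \o f) z w|.
  have /choice[c Hc] : forall k, exists c : I -> R, forall l, 0 <= c l /\
      forall (f : plane R -> M) z, {for z, continuous f} ->
      in_box (B k) (f z) -> in_box (B l) (f z) -> differentiable (bfwd (B k) \o f)
        z ->
      forall w, `|'d (bfwd (B l) \o f) z w| <= c l * `|'d (bfwd (B k) \o f) z w|.
    move=> k; suff /choice[c Hc] : forall l, exists c : R, 0 <= c /\
        forall (f : plane R -> M) z, {for z, continuous f} ->
        in_box (B k) (f z) -> in_box (B l) (f z) ->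
        differentiable (bfwd (B k) \o f) z -> forall w,
        `|'d (bfwd (B l) \o f) z w| <= c * `|'d (bfwd (B k) \o f) z w| by exists c.
    by move=> l; have [c c0 Hc] := box_change hausM (B k) (B l); exists c.
  by exists c.
exists I, B, iota, (1 + \sum_k \sum_l c k l); split=> //.
  by rewrite lerDl; apply: sumr_ge0 => k _; apply: sumr_ge0 => l _; have [] := Hc k l.
move=> k l f z cf kz lz df w; have [_ H] := Hc k l.
apply: le_trans (H f z cf kz lz df w) _; apply: ler_wpM2r => //.
have c0 i j : 0 <= c i j by have [] := Hc i j.
have kl : c k l <= \sum_j c k j by rewrite (bigD1 l)//= lerDl sumr_ge0.
apply: (le_trans kl); apply: (@le_trans _ _ (\sum_i \sum_j c i j)).
  by rewrite [leRHS](bigD1 k)//= lerDl; apply: sumr_ge0 => i _; exact: sumr_ge0.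
by rewrite lerDr.
Qed.

End FiniteAtlas.

Theorem mainTheorem1 (R : realType) (n : nat) (M : topologicalType)
    (X : manifold R M n) (J : almost_complex X 2) (hM : compact [set: M]) :
  ~ hyperbolic J <->
  exists f : plane R -> M,
    J_holomorphic J [set: plane R] f /\ (exists z w, f z <> f w).
Proof.
split=> [nhyp|[f [Hf [z [w zw]]]] hyp]; last by apply: zw; apply: hyp;
  exact: kobayashi_line.
have hausM := mfd_hausdorff X.
have [I [B [iota [lam [iotaP lam1 lamP]]]]] := @box_system R M n X hausM hM.
have unbounded K : exists2 f, J_holomorphic J (@disk R) f & K < box_speed B iota f 0.
  apply: contrapT => bounded; apply: nhyp.
  apply: (@bounded_speed_hyperbolic R M n X J I B iota lam hausM iotaP lam1 lamP
    (Num.max 0 K)).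
    by rewrite le_max lexx.
  move=> f Hf; rewrite le_max; apply/orP; right; rewrite leNgt; apply/negP => Kf.
  by apply: bounded; exists f.
have [h Hh] := choice (brody_reparametrization iotaP lam1 lamP unbounded).
have hJ k : J_holomorphic J (ball 0 k.+1%:R) (h k) by have [] := Hh k.
have h0 k : box_speed B iota (h k) 0 = 1 by have [] := Hh k.
have hC k z : ball 0 k.+1%:R z -> box_speed B iota (h k) z <= 4 by have [_ _] :=
  Hh k; apply.
have [F [FU Finf]] := ultraFilterLemma (eventually_filter : ProperFilter \oo).
have [f hf] : exists f : plane R -> M, forall z, h k z @[k --> F] --> f z.
  suff /choice[f hf] : forall z, exists p : M, h k z @[k --> F] --> p by exists f.
  move=> z; have [|p _ Hp] := ultra_compact_cvg FU (h := fun k => h k z) hM.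
    exact: filterT.
  by exists p.
exists f; split.
  exact: (limit_holomorphic hausM iotaP lam1 lamP (ler0n R 4) hJ hC FU Finf hf).
exact: (limit_nonconstant hausM iotaP lam1 lamP (ler0n R 4) hJ h0 hC FU Finf hf).
Qed.
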